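(* Let $\{E_1,\dots,E_r\}$ be $r$ distinct irreducible components of the exceptional divisor of a modification $\pi:(\mathcal X,\mathcal D)\to(\mathbb C^2,0)$, and $\{E'_1,\dots,E'_r\}$ be $r$ distinct irreducible components of the exceptional divisor of a modification $\pi':(\mathcal X',\mathcal D')\to(\mathbb C^2,0)$. Let $v_i$ (resp. $v'_i$) be the divisorial valuation defined by $E_i$ (resp. $E'_i$). If the Poincaré series coincide, $P_{\{v_i\}}(t_1,\dots,t_r)=P_{\{v'_i\}}(t_1,\dots,t_r)$, then the minimal resolutions of the sets of divisors $\{E_1,\dots,E_r\}$ and $\{E'_1,\dots,E'_r\}$ are combinatorially equivalent, i.e. there is an isomorphism of their dual graphs preserving the partial orders of vertices and sending the vertex of $E_i$ to the vertex of $E'_i$ for each $i$. In short: the Poincaré series of a set of divisorial valuations on $\mathcal O_{\mathbb C^2,0}$ determines the minimal resolution of the set of divisors up to combinatorial equivalence.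
   Context: A modification $\pi:(\mathcal X,\mathcal D)\to(\mathbb C^2,0)$ is a proper analytic map from a nonsingular surface $\mathcal X$, an isomorphism outside the origin, with $\mathcal D=\pi^{-1}(0)$ a normal crossing divisor; it is a composition of point blow-ups. $\mathcal D=\bigcup_{\sigma\in\Gamma}E_\sigma$ with each $E_\sigma\cong\mathbb{CP}^1$. The dual graph has vertex set $\Gamma$, with an edge between two vertices iff the components intersect; it is a tree. $\Gamma$ carries the partial order: $\sigma'>\sigma$ iff the exceptional divisor of the minimal modification containing $E_{\sigma'}$ also contains $E_\sigma$. Two modifications are combinatorially equivalent if their dual graphs together with these partial orders are isomorphic. For $f\in\mathcal O_{\mathbb C^2,0}$, $v_\sigma(f)$ is the multiplicity of $f\circ\pi$ along $E_\sigma$ ($v_\sigma(0)=\infty$); this is the divisorial valuation of $E_\sigma$. The minimal resolution of a set of divisors is the minimal modification in which all of them appear. For valuations $v_1,\dots,v_r$, set $\underline v(f)=(v_1(f),\dots,v_r(f))$, and for $\underline v\in\mathbb Z^r$ let $J(\underline v)=\{f:\underline v(f)\ge\underline v\}$ (componentwise order). Let $L(t_1,\dots,t_r)=\sum_{\underline v\in\mathbb Z^r}\dim\big(J(\underline v)/J(\underline v+\underline 1)\big)\,\underline t^{\underline v}$ with $\underline 1=(1,\dots,1)$; then $P'=L\cdot\prod_{i=1}^r(t_i-1)$ is a power series and the Poincaré series is $P_{\{v_i\}}(t_1,\dots,t_r)=P'(t_1,\dots,t_r)/(t_1\cdots t_r-1)$. *)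

(* Defs.v *)
From HB Require Import structures.
From mathcomp Require Import all_boot all_order all_algebra.
From mathcomp Require Import reals complex.
From Stdlib Require Import ClassicalEpsilon.
Set Implicit Arguments. Unset Strict Implicit. Unset Printing Implicit Defensive.
Import Order.TTheory GRing.Theory Num.Theory.
Local Open Scope ring_scope.

(* A direction at a point = a point of the exceptional P^1 obtained by
   blowing it up, in the local coordinates (x,y) of that point:
   [Some c] = the direction of the line y = c x, [None] = the line x = 0. *)
Definition dir (R : realType) := option R[i].

(* An infinitely near point of the origin of C^2: the finite sequence of
   directions leading to it ([::] is the origin itself).  Blowing up the
   point [p] creates the exceptional component E_p. *)
Definition ipt (R : realType) := seq (dir R).

(* Bivariate power series in two variables: f = sum_{a,b} f a b x^a y^b. *)
Definition series (R : realType) := nat -> nat -> R[i].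

Definition convergent (R : realType) (f : series R) : Prop :=
  exists rho M : R, 0 < rho /\
    forall i j, ComplexField.Normc.normc (f i j) * rho ^+ (i + j) <= M.

(* Pull back along one blow-up chart.
   [Some c]: (x,y) = (u, u (v + c));  [None]: (x,y) = (u v, v).
   The new local coordinates (u,v) are centred at the chosen point. *)
Definition stepT (R : realType) (d : dir R) (f : series R) : series R :=
  fun a b =>
    match d with
    | Some c => \sum_(j < a.+1 | (b <= j)%N)
                  f (a - j)%N j * ('C(j, b))%:R * c ^+ (j - b)
    | None => if (a <= b)%N then f a (b - a)%N else 0
    end.

Definition pull (R : realType) (p : ipt R) (f : series R) : series R :=
  foldl (fun g d => stepT d g) f p.

(* f o pi in a chart of the blow-up of p in which E_p = {u = 0}. *)
Definition chartE (R : realType) (p : ipt R) (f : series R) : series R :=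
  stepT (Some 0) (pull p f).

Definition is_uord (R : realType) (g : series R) (o : option nat) : Prop :=
  match o with
  | None => forall a b, g a b = 0
  | Some n => (exists b, g n b != 0) /\ forall a b, (a < n)%N -> g a b = 0
  end.

Definition uord (R : realType) (g : series R) : option nat :=
  epsilon (inhabits None) (is_uord g).

(* The divisorial valuation v_{E_p}(f): multiplicity of f o pi along E_p
   (None stands for +oo). *)
Definition divval (R : realType) (p : ipt R) (f : series R) : option nat :=
  uord (chartE p f).

Definition vge (o : option nat) (k : int) : Prop :=
  match o with None => True | Some n => (k <= n%:Z)%R end.

Definition Jset (R : realType) (r : nat) (P : 'I_r -> ipt R) (w : 'I_r -> int)
  : series R -> Prop :=
  fun f => convergent f /\ forall i, vge (divval (P i) f) (w i).

Definition lincomb (R : realType) (d : nat) (c : 'I_d -> R[i])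
  (fs : 'I_d -> series R) : series R :=
  fun a b => \sum_(k < d) c k * fs k a b.

Definition IsQuotDim (R : realType) (A B : series R -> Prop) (d : nat) : Prop :=
  (exists fs : 'I_d -> series R, (forall k, A (fs k)) /\
     forall c : 'I_d -> R[i], B (lincomb c fs) -> forall k, c k = 0)
  /\ (forall fs : 'I_d.+1 -> series R, (forall k, A (fs k)) ->
        exists c : 'I_d.+1 -> R[i], (exists k, c k != 0) /\ B (lincomb c fs)).

Definition qdim (R : realType) (A B : series R -> Prop) : nat :=
  epsilon (inhabits 0%N) (IsQuotDim A B).

Definition Lcoef (R : realType) (r : nat) (P : 'I_r -> ipt R) (w : 'I_r -> int)
  : int :=
  (qdim (Jset P w) (Jset P (fun i => w i + 1)))%:Z.

(* coefficient of t^w (w in N^r) in P' = L * prod_i (t_i - 1) *)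
Definition Pprime (R : realType) (r : nat) (P : 'I_r -> ipt R) (w : 'I_r -> nat)
  : int :=
  \sum_(S : {set 'I_r})
     (-1) ^+ (r - #|S|) * Lcoef P (fun i => (w i)%:Z - ((i \in S) : nat)%:Z).

(* coefficient of t^w in the power series P' / (t_1 ... t_r - 1) *)
Definition Poincare (R : realType) (r : nat) (P : 'I_r -> ipt R) (w : 'I_r -> nat)
  : int :=
  - \sum_(k < (\sum_i w i).+1 | [forall i, (k <= w i)%N])
      Pprime P (fun i => (w i - k)%N).

(* A modification = the finite set of (infinitely near) points blown up,
   which must be closed under taking preceding points. *)
Definition is_modif (R : realType) (M : seq (ipt R)) : Prop :=
  forall q, q \in M -> forall s, prefix s q -> s \in M.

(* sigma < sigma' : E_sigma is created before E_sigma' in the minimal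
   modification containing E_sigma'. *)
Definition pprefix (R : realType) (p q : ipt R) : bool := prefix p q && (p != q).

(* In the local coordinates (u,v) at a point, the exceptional components
   through it are among {u = 0}, {v = 0}; we track which ones. *)
Definition lab_step (R : realType)
  (st : ipt R * option (ipt R) * option (ipt R)) (d : dir R) :=
  let: (s, A, B) := st in
  match d with
  | Some c => (rcons s d, Some s, if c == 0 then B else None)
  | None => (rcons s d, A, Some s)
  end.

Definition labels (R : realType) (q : ipt R) :=
  foldl (@lab_step R) ([::], None, None) q.

(* q lies on the strict transform of E_p *)
Definition proximate (R : realType) (q p : ipt R) : bool :=
  let: (_, A, B) := labels q in (A == Some p) || (B == Some p).

(* for p < q, E_p and E_q meet in the modification with vertex set V *)
Definition meets_up (R : realType) (V : ipt R -> Prop) (p q : ipt R) : Prop :=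
  proximate q p /\ ~ (exists q', V q' /\ pprefix q q' /\ proximate q' p).

Definition dual_edge (R : realType) (V : ipt R -> Prop) (p q : ipt R) : Prop :=
  V p /\ V q /\ (meets_up V p q \/ meets_up V q p).

Definition minres (R : realType) (r : nat) (P : 'I_r -> ipt R) : ipt R -> Prop :=
  fun s => exists i, prefix s (P i).

Definition comb_equiv (R : realType) (r : nat) (P P' : 'I_r -> ipt R) : Prop :=
  let V := minres P in let V' := minres P' in
  exists phi : ipt R -> ipt R,
    (forall s, V s -> V' (phi s)) /\
    (forall s t, V s -> V t -> phi s = phi t -> s = t) /\
    (forall s', V' s' -> exists s, V s /\ phi s = s') /\
    (forall s t, V s -> V t -> (dual_edge V s t <-> dual_edge V' (phi s) (phi t))) /\
    (forall s t, V s -> V t -> (pprefix s t <-> pprefix (phi s) (phi t))) /\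
    (forall i, phi (P i) = P' i).

(* Main.v *)
Require Import Defs.
From HB Require Import structures.
From mathcomp Require Import all_boot all_order all_algebra.
From mathcomp Require Import reals complex.
From mathcomp Require Import boolp functions zify.
From Stdlib Require Import ClassicalEpsilon.
Set Implicit Arguments. Unset Strict Implicit. Unset Printing Implicit Defensive.
Import Order.TTheory GRing.Theory Num.Theory.
Local Open Scope ring_scope.

(** Let [h(w)] be the codimension of [J(w)].  Up to sign the Poincare series is the
    mixed difference of [h] in all directions; since the order at the origin bounds
    every divisorial value (Izumi), the mixed differences in fewer directions vanish
    far away, and the series determines [h], hence [h] for each [v_i] and each pair
    [v_i], [v_j].

    Blowing up the origin, an ideal of order [n] given by valuations has codimension
    [n(n+1)/2] plus the codimensions of its transforms, while for every other [n]
    this sum is an upper bound.  Hence the Legendre transform of [h] is a sum over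
    the points [p] that are blown up:
      [max_w (a.w - b h(w)) = sum_p max_n (n (a.e_p) - b n(n+1)/2)],
    with [e_p] the multiplicities at [p] of generic curvettes of the divisors.  For a
    single valuation this determines the multiset of the [e_p], which is the
    multiplicity sequence because that sequence decreases; for a pair, [a = (1,1)] and
    [b = 1] give the intersection number of the two curvettes, which counts the
    common points.  Finally [q] is proximate to [p] exactly when the multiplicities
    strictly between them on the chain add up to less than [e_p]. *)

(** * Codimension of linear subsets *)

Section LinearSubset.
Variables (K : fieldType) (V : lmodType K).
Implicit Types (J : V -> Prop).

Definition linset J :=
  J 0 /\ forall c f g, J f -> J g -> J (c *: f + g).

Lemma linset_sum J (I : Type) (r : seq I) (c : I -> K) (F : I -> V) :
  linset J -> (forall i, J (F i)) -> J (\sum_(i <- r) c i *: F i).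
Proof.
move=> [J0 JD] JF; elim: r => [|i r IH]; first by rewrite big_nil.
by rewrite big_cons; apply: JD.
Qed.

Lemma linsetD J f g : linset J -> J f -> J g -> J (f + g).
Proof. by move=> [J0 JD] Jf Jg; rewrite -[f]scale1r; apply: JD. Qed.

Lemma linsetZ J c f : linset J -> J f -> J (c *: f).
Proof. by move=> [J0 JD] Jf; rewrite -[_ *: _]addr0; apply: JD. Qed.

End LinearSubset.

Section Codim.
Variables (K : fieldType) (V : lmodType K).
Implicit Types (J : V -> Prop) (m n : nat).

(** A surjection onto ['rV_m] with kernel [J] stands for the quotient by [J], so that codimension
    arguments become matrix computations. *)
Definition cod J m := exists phi : {linear V -> 'rV[K]_m},
  (forall f, J f <-> phi f = 0) /\ forall c, exists f, phi f = c.

Lemma linear_row (m : nat) (phi : {linear V -> 'rV[K]_m}) (I : finType)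
  (c : I -> K) (F : I -> V) :
  phi (\sum_i c i *: F i) = \sum_i c i *: phi (F i).
Proof. by rewrite linear_sum; apply: eq_bigr => i _; rewrite linearZ. Qed.

Lemma cod_lift m (phi : {linear V -> 'rV[K]_m}) :
  (forall c, exists f, phi f = c) ->
  exists F : 'I_m -> V, forall c : 'rV_m, phi (\sum_i c 0 i *: F i) = c.
Proof.
move=> sphi.
have [F HF] : exists F : 'I_m -> V, forall i, phi (F i) = delta_mx 0 i.
  by apply: (@fin_all_exists _ _ (fun i f => phi f = delta_mx 0 i)) => i.
exists F => c; rewrite linear_row [RHS]row_sum_delta.
by apply: eq_bigr => i _; rewrite HF.
Qed.

(** A relation between the images under [Phi] of lifts of a basis yields a vector killed by [Phi],
    hence lying in [J], so the relation is trivial. *)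
Lemma cod_le_ker J m t (Phi : {linear V -> 'rV[K]_t}) :
  cod J m -> (forall f, Phi f = 0 -> J f) -> (m <= t)%N.
Proof.
move=> [phi [kphi sphi]] kPhi; have [F HF] := cod_lift sphi.
pose M := \matrix_(i < m) Phi (F i).
have kM : kermx M = 0.
  apply/row_matrixP => i; rewrite row0; set c := row i _.
  have cM : c *m M = 0 by apply/sub_kermxP; exact: row_sub.
  rewrite -[c]HF; apply/kphi/kPhi; rewrite linear_row -[RHS]cM mulmx_sum_row.
  by apply: eq_bigr => j _; rewrite rowK.
have : row_free M by rewrite -kermx_eq0 kM.
by rewrite /row_free => /eqP <-; exact: rank_leq_col.
Qed.

Lemma cod_factor J J' m m' : cod J m -> cod J' m' -> (forall f, J' f -> J f) ->
  exists phi' : {linear V -> 'rV[K]_m'}, exists M : 'M[K]_(m', m),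
  [/\ (forall f, J' f <-> phi' f = 0), (forall c, exists f, phi' f = c),
      (forall f, J f <-> phi' f *m M = 0) & \rank M = m].
Proof.
move=> [phi [kphi sphi]] [phi' [kphi' sphi']] JJ; have [F HF] := cod_lift sphi'.
pose M := \matrix_(i < m') phi (F i).
have fac f : phi f = phi' f *m M.
  apply/eqP; rewrite -subr_eq0; apply/eqP.
  have -> : phi' f *m M = phi (\sum_i phi' f 0 i *: F i).
    by rewrite linear_row mulmx_sum_row; apply: eq_bigr => i _; rewrite rowK.
  rewrite -linearB; apply/kphi/JJ/kphi'.
  by rewrite linearB HF subrr.
exists phi', M; split=> //; first by move=> f; rewrite kphi fac.
apply/eqP; change (row_full M); rewrite -sub1mx; apply/row_subP => i.
have [f <-] := sphi (row i 1%:M); rewrite fac; exact: submxMl.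
Qed.

Lemma cod_mono J J' m m' : cod J m -> cod J' m' -> (forall f, J' f -> J f) ->
  (m <= m')%N.
Proof.
move=> cJ cJ' JJ; have [phi' [M [_ _ _ <-]]] := cod_factor cJ cJ' JJ.
exact: rank_leq_row.
Qed.

Lemma cod_uniq J J' m m' : cod J m -> cod J' m' -> (forall f, J' f <-> J f) ->
  m = m'.
Proof.
move=> cJ cJ' JJ; apply/eqP; rewrite eqn_leq.
by rewrite (cod_mono cJ cJ') ?(cod_mono cJ' cJ) // => f /JJ.
Qed.

(** An element of [K'] adjusts [psi] without changing [phi], so the joint map is onto. *)
Lemma cod_ext J K' s t (psi : {linear V -> 'rV[K]_t}) :
  cod K' s -> (forall f, J f <-> K' f /\ psi f = 0) ->
  (forall c, exists2 f, K' f & psi f = c) -> cod J (s + t).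
Proof.
move=> [phi [kphi sphi]] HJ spsi.
pose Phi f := row_mx (phi f) (psi f).
have linP : linear Phi.
  by move=> a f g; rewrite /Phi !linearP /= scale_row_mx add_row_mx.
pose L := HB.pack_for {linear V -> 'rV[K]_(s + t)} Phi
  (GRing.isLinear.Build _ _ _ _ Phi linP).
exists L; split=> [f|c].
  rewrite HJ kphi; split=> [[Hp Hq]|].
    by change (row_mx (phi f) (psi f) = 0); rewrite Hp Hq row_mx0.
  change (row_mx (phi f) (psi f) = 0 -> phi f = 0 /\ psi f = 0).
  by rewrite -row_mx0 => /eq_row_mx.
have [f Hf] := sphi (lsubmx c); have [g /kphi Kg Hg] := spsi (rsubmx c - psi f).
exists (f + g); change (row_mx (phi (f + g)) (psi (f + g)) = c).
by rewrite !linearD Kg Hf Hg addr0 addrC subrK hsubmxK.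
Qed.

Lemma linset_mx n (S : 'rV[K]_n -> Prop) : linset S ->
  exists U : 'M[K]_n, forall v, S v <-> (v <= U)%MS.
Proof.
move=> LS.
pose Q k := `[< exists U : 'M[K]_n, \rank U = k /\ forall i, S (row i U) >].
have Q0 : exists k, Q k.
  exists 0%N; apply/asboolP; exists 0; rewrite mxrank0; split=> // i.
  by rewrite row0; case: LS.
have Qn k : Q k -> (k <= n)%N by move=> /asboolP [U [<- _]]; exact: rank_leq_row.
case: (ex_maxnP Q0 Qn) => k /asboolP [U [rU SU]] max.
have sub v : (v <= U)%MS -> S v.
  by move=> /submxP[D ->]; rewrite mulmx_sum_row; apply: linset_sum.
exists U => v; split; last exact: sub.
move=> Sv; apply: contrapT => /negP nv.
pose W := (U + v)%MS.
have : Q (\rank W).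
  apply/asboolP; exists W; split=> // i.
  have : (row i W <= U + v)%MS by exact: row_sub.
  move=> /sub_addsmxP [[a b] /= ->]; apply: linsetD => //.
    by apply: sub; exact: submxMl.
  have /submxP [D ->] : (b *m v <= v)%MS by exact: submxMl.
  by rewrite (mx11_scalar D) mul_scalar_mx; apply: linsetZ.
move=> /max; rewrite leqNgt -rU => /negP; apply.
rewrite ltn_neqAle mxrankS ?addsmxSl // andbT; apply: contra nv => /eqP eqr.
have : (U == W)%MS by rewrite -mxrank_leqif_eq ?addsmxSl // eqr.
by move=> /andP [_]; apply: submx_trans; exact: addsmxSr.
Qed.

Lemma cod_exists J K' s : linset J -> cod K' s -> (forall f, K' f -> J f) ->
  exists m, cod J m.
Proof.
move=> LJ [phi [kphi sphi]] KJ.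
have [|U HU] := @linset_mx s (fun v => exists2 f, J f & phi f = v).
  split; first by exists 0; [case: LJ | rewrite linear0].
  move=> c _ _ [f Jf <-] [g Jg <-]; exists (c *: f + g); last by rewrite linearP.
  by case: LJ => _; apply.
(* [cokermx U] has kernel [U] but need not be onto; its column base has the same kernel and full
   column rank. *)
pose B := col_base (cokermx U).
exists (\rank (cokermx U)).
pose Phi f := phi f *m B.
have linP : linear Phi by move=> a f g; rewrite /Phi linearP mulmxDl scalemxAl.
pose L := HB.pack_for {linear V -> 'rV[K]_(\rank (cokermx U))} Phi
  (GRing.isLinear.Build _ _ _ _ Phi linP).
exists L; split=> [f|c].
  change (J f <-> phi f *m B = 0).
  have -> : J f <-> (phi f <= U)%MS.
    rewrite -HU; split=> [Jf|[g Jg eqg]]; first by exists f.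
    rewrite -[f](subrK g); apply: linsetD => //; apply/KJ/kphi.
    by rewrite linearB eqg subrr.
  have -> : (phi f <= U)%MS <-> phi f *m B *m row_base (cokermx U) = 0.
    by rewrite -mulmxA mulmx_base submxE; split=> /eqP.
  split=> [H|->]; last by rewrite mul0mx.
  have /row_freeP [D HD] := row_base_free (cokermx U).
  by rewrite -[phi f *m B]mulmx1 -HD mulmxA H mul0mx.
have /row_fullP [D HD] := col_base_full (cokermx U).
have [f Hf] := sphi (c *m D); exists f; change (phi f *m B = c).
by rewrite Hf -mulmxA HD mulmx1.
Qed.

End Codim.

(** * Orders and blow-up charts *)

Section Charts.
Variable R : realType.
Implicit Types (f g : series R) (d : dir R) (p q : ipt R).

Definition ordge n f := forall a b, (a + b < n)%N -> f a b = 0.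

Definition mulX f : series R := fun a b => if a is a'.+1 then f a' b else 0.
Definition mulY f : series R := fun a b => if b is b'.+1 then f a b' else 0.

(** The degree [n] form of [f] at [x = 1], as a polynomial in [y]. *)
Definition hform n f : {poly R[i]} := \poly_(j < n.+1) f (n - j)%N j.

Lemma seriesP f g : (forall a b, f a b = g a b) -> f = g.
Proof. by move=> fg; apply: funext => a; apply: funext => b. Qed.

Lemma seriesDE f g a b : (f + g) a b = f a b + g a b. Proof. by []. Qed.
Lemma seriesZE c f a b : (c *: f) a b = c * f a b. Proof. by []. Qed.
Lemma seriesBE f g a b : (f - g) a b = f a b - g a b. Proof. by []. Qed.
Lemma series0E a b : (0 : series R) a b = 0. Proof. by []. Qed.

Lemma ordge_linset n : linset (ordge n).
Proof.
split=> // c f g Hf Hg a b ab.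
by rewrite seriesDE seriesZE Hf ?Hg // mulr0 addr0.
Qed.

Lemma ordgeW m n f : (m <= n)%N -> ordge n f -> ordge m f.
Proof. by move=> mn Hf a b ab; apply: Hf; exact: leq_trans mn. Qed.

Lemma ordge0 f : ordge 0 f. Proof. by []. Qed.

Lemma hformE n f j : (hform n f)`_j = if (j <= n)%N then f (n - j)%N j else 0.
Proof. by rewrite coef_poly ltnS. Qed.

Lemma size_hform n f : (size (hform n f) <= n.+1)%N.
Proof. exact: size_poly. Qed.

Lemma hformP n c f g : hform n (c *: f + g) = c *: hform n f + hform n g.
Proof.
by apply/polyP => j; rewrite coefD coefZ !hformE; case: ifP; rewrite ?mulr0 ?addr0.
Qed.

Lemma hform_mulX n f : hform n (mulX f) = if n is n'.+1 then hform n' f else 0.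
Proof.
apply/polyP => j; case: n => [|n]; first by rewrite hformE coef0; case: j.
rewrite !hformE; case: (leqP j n) => jn; first by rewrite leqW // subSn.
case: ifP => // jn1; have -> : j = n.+1 by lia.
by rewrite subnn.
Qed.

Lemma hform_mulY n f :
  hform n (mulY f) = if n is n'.+1 then 'X * hform n' f else 0.
Proof.
apply/polyP => j; case: n => [|n]; first by rewrite hformE coef0; case: j.
by rewrite coefXM !hformE; case: j => [|j] //=; rewrite subSS ltnS.
Qed.

Lemma ordge_hform n f : ordge n f <-> forall k, (k < n)%N -> hform k f = 0.
Proof.
split=> [Hf k kn|Hf a b ab].
  by apply/polyP => j; rewrite hformE coef0; case: leqP => // jk; apply: Hf; lia.
have := congr1 (fun p : {poly _} => p`_b) (Hf _ ab).
by rewrite /= hformE coef0 leq_addl addnK.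
Qed.

(** Under [x = u], [y = u (v + c)] a form of degree [a] becomes [u^a] times its value at
    [(1, v + c)]. *)
Lemma stepT_some c f a b :
  stepT (Some c) f a b = (hform a f \Po ('X + c%:P))`_b.
Proof.
rewrite /stepT /hform poly_def raddf_sum coef_sum /= big_mkcond.
apply: eq_bigr => j _; rewrite /= comp_polyZ coefZ comp_Xn_poly.
rewrite addrC exprDn coef_sum; case: leqP => bj; last first.
  rewrite big1 ?mulr0 // => i _.
  rewrite coefMn -rmorphXn /= coefCM coefXn.
  case: eqP => [bi|]; last by rewrite mulr0 mul0rn.
  by have := ltn_ord i; rewrite -bi ltnS leqNgt bj.
have bj' : (b < j.+1)%N by [].
rewrite (bigD1 (Ordinal bj')) //= big1 ?addr0 => [|i ib].
  rewrite coefMn -rmorphXn /= coefCM coefXn eqxx mulr1.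
  by rewrite -mulrA mulr_natl.
rewrite coefMn -rmorphXn /= coefCM coefXn eq_sym.
case: eqP => [bi|]; last by rewrite mulr0 mul0rn.
by move: ib; rewrite -(inj_eq val_inj) /= bi eqxx.
Qed.

Lemma stepT_none f a b :
  stepT None f a b = if (a <= b)%N then (hform b f)`_(b - a) else 0.
Proof. by rewrite /= hformE leq_subr; case: leqP => // ab; rewrite subKn. Qed.

Lemma stepT_linear d : linear (stepT d : series R -> series R).
Proof.
move=> c f g; apply: seriesP => a b; case: d => [t|]; last first.
  by rewrite seriesDE seriesZE /=; case: ifP; rewrite ?mulr0 ?addr0.
rewrite seriesDE seriesZE !stepT_some hformP.
by rewrite comp_polyD comp_polyZ coefD coefZ.
Qed.

HB.instance Definition _ d :=
  GRing.isLinear.Build _ _ _ _ (stepT d : series R -> series R) (stepT_linear d).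

Lemma mulX_linear : linear mulX.
Proof.
move=> c f g; apply: seriesP => -[|a] b //=.
by rewrite seriesDE seriesZE mulr0 addr0.
Qed.
HB.instance Definition _ := GRing.isLinear.Build _ _ _ _ mulX mulX_linear.

Lemma pull_cons d q f : pull (d :: q) f = pull q (stepT d f).
Proof. by []. Qed.

Lemma pull_linear q : linear (pull q : series R -> series R).
Proof. by elim: q => [|d q IH] c f g //; rewrite !pull_cons linearP IH. Qed.

Lemma mulXY f : mulX (mulY f) = mulY (mulX f).
Proof. by apply: seriesP => -[|a] [|b]. Qed.

Lemma stepT_mulX c f : stepT (Some c) (mulX f) = mulX (stepT (Some c) f).
Proof.
apply: seriesP => a b; rewrite stepT_some hform_mulX.
by case: a => [|a] /=; rewrite ?comp_poly0 ?coef0 // -stepT_some.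
Qed.

Lemma stepT_mulY c f : stepT (Some c) (mulY f) =
  mulX (mulY (stepT (Some c) f) + c *: stepT (Some c) f).
Proof.
apply: seriesP => a b; rewrite stepT_some hform_mulY.
case: a => [|a]; rewrite ?comp_poly0 ?coef0 //.
rewrite comp_polyM comp_polyX mulrDl coefD coefXM coefCM /mulX seriesDE seriesZE.
by rewrite stepT_some; congr (_ + _); case: b => [|b] //; rewrite /mulY stepT_some.
Qed.

Lemma stepT_none_mulX f : stepT None (mulX f) = mulX (mulY (stepT None f)).
Proof. by apply: seriesP => -[|a] [|b]. Qed.

Lemma stepT_none_mulY f : stepT None (mulY f) = mulY (stepT None f).
Proof.
apply: seriesP => a [|b] /=; first by case: a.
case: (leqP a b) => ab; first by rewrite leqW // subSn.
case: ifP => // ab1; have -> : a = b.+1 by lia.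
by rewrite subnn.
Qed.

Lemma stepT_ordge d n f : ordge n f -> ordge n (stepT d f).
Proof.
move=> /ordge_hform Hf a b ab; case: d => [c|].
  by rewrite stepT_some Hf ?comp_poly0 ?coef0 //; lia.
by rewrite stepT_none; case: ifP => // _; rewrite Hf ?coef0 //; lia.
Qed.

Lemma pull0 q : pull q (0 : series R) = 0.
Proof.
elim: q => //= d q IH; rewrite -[RHS]IH; congr (pull q _).
apply: seriesP => a b; rewrite series0E; case: d => [c|].
  rewrite stepT_some (_ : hform a 0 = 0) ?comp_poly0 ?coef0 //.
  by apply/polyP => j; rewrite hformE coef0 if_same.
by rewrite /= if_same.
Qed.

Lemma mulXB f g : mulX (f - g) = mulX f - mulX g.
Proof. by apply: seriesP => -[|a] b //=; rewrite seriesBE subr0. Qed.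

Lemma pull_ordge q n f : ordge n f -> ordge n (pull q f).
Proof. by elim: q f => [//|d q IH] f Hf; apply/IH/stepT_ordge. Qed.

Lemma comp_translate_eq0 (K : fieldType) (c : K) (h : {poly K}) :
  h \Po ('X + c%:P) = 0 -> h = 0.
Proof.
move=> Hh; have := congr1 (fun w => w \Po ('X - c%:P)) Hh.
rewrite /= comp_poly0 -comp_polyA comp_polyD comp_polyX comp_polyC.
by rewrite subrK comp_polyXr.
Qed.

Lemma size_comp_translate (K : fieldType) (c : K) (h : {poly K}) n :
  (size h <= n)%N -> (size (h \Po ('X + c%:P)) <= n)%N.
Proof. by rewrite size_comp_poly2 // size_XaddC. Qed.

(** The degree [k] form becomes the [k]-th power of the exceptional coordinate times a polynomial of
    degree at most [k] in the other one, and different [k] do not interfere; for [k < n] it is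
    therefore visible in total degree below [2 n]. *)
Lemma stepT_ordge_inv d n f : ordge n.*2 (stepT d f) -> ordge n f.
Proof.
move=> Hf; apply/ordge_hform => k kn; case: d Hf => [c|] Hf.
  apply: (@comp_translate_eq0 _ c); apply/polyP => b; rewrite coef0 -stepT_some.
  case: (leqP b k) => bk; first by apply: Hf; lia.
  rewrite stepT_some nth_default //; apply: leq_trans bk.
  exact/size_comp_translate/size_hform.
apply/polyP => j; rewrite coef0 hformE; case: leqP => // jk.
have := Hf (k - j)%N k; rewrite stepT_none leq_subr subKn // hformE jk.
by apply; lia.
Qed.

(* Izumi's inequality: the order at the origin controls every divisorial value. *)
Lemma pull_ordge_inv q n f : ordge (2 ^ size q * n) (pull q f) -> ordge n f.
Proof.
elim: q f n => [|d q IH] f n; first by rewrite mul1n.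
by rewrite pull_cons expnS -mulnA mulnCA mul2n => /IH /stepT_ordge_inv.
Qed.

(* Multiplication by a polynomial with constant term [a]. *)
Inductive pop : (series R -> series R) -> R[i] -> Prop :=
| pop_id : pop (fun g => g) 1
| pop_X : pop mulX 0
| pop_Y : pop mulY 0
| pop_scale c : pop (fun g => c *: g) c
| pop_add T1 T2 a b : pop T1 a -> pop T2 b -> pop (fun g => T1 g + T2 g) (a + b)
| pop_comp T1 T2 a b : pop T1 a -> pop T2 b -> pop (fun g => T1 (T2 g)) (a * b).

(** A substitution turns polynomial multipliers into polynomial multipliers; the constant term
    survives because [x] and [y] both vanish at the new origin. *)
Lemma pop_stepT T a d : pop T a ->
  exists2 T', pop T' a & forall g, stepT d (T g) = T' (stepT d g).
Proof.
elim=> {T a} [|||c|T1 T2 a b _ [T1' p1 H1] _ [T2' p2 H2]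
             |T1 T2 a b _ [T1' p1 H1] _ [T2' p2 H2]].
- by exists (fun g => g) => //; exact: pop_id.
- case: d => [c|]; first by exists mulX; [exact: pop_X | exact: stepT_mulX].
  exists (fun g => mulX (mulY g)); last exact: stepT_none_mulX.
  by rewrite -[0](mulr0 0); apply: pop_comp pop_X pop_Y.
- case: d => [c|]; last by exists mulY; [exact: pop_Y | exact: stepT_none_mulY].
  exists (fun g => mulX (mulY g + c *: g)); last exact: stepT_mulY.
  rewrite -[0](mul0r (0 + c)); apply: (pop_comp pop_X).
  exact: pop_add pop_Y (pop_scale c).
- by exists (fun g => c *: g); [exact: pop_scale | move=> g; rewrite linearZ].
- exists (fun g => T1' g + T2' g); first exact: pop_add.
  by move=> g; rewrite linearD /= H1 H2.
- exists (fun g => T1' (T2' g)); first exact: pop_comp.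
  by move=> g; rewrite H1 H2.
Qed.

(** Only the constant term of a multiplier acts on the lowest form, so a multiplier with nonzero
    constant term preserves the order. *)
Lemma pop_lead T a k g : pop T a -> ordge k g ->
  ordge k (T g) /\ forall i j, (i + j = k)%N -> T g i j = a * g i j.
Proof.
move=> pT; elim: pT k g => {T a} [|||c|T1 T2 a b _ H1 _ H2|T1 T2 a b _ H1 _ H2] k g Hg.
- by split=> // i j _; rewrite mul1r.
- by split=> [[|i] j ij|[|i] j ij] //=; rewrite ?mul0r // Hg //; lia.
- by split=> [i [|j] ij|i [|j] ij] //=; rewrite ?mul0r // Hg //; lia.
- by split=> // i j ij; rewrite seriesZE Hg ?mulr0.
- have [O1 E1] := H1 _ _ Hg; have [O2 E2] := H2 _ _ Hg; split=> i j ij.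
    by rewrite seriesDE O1 ?O2 ?addr0.
  by rewrite seriesDE E1 ?E2 // mulrDl.
- have [O2 E2] := H2 _ _ Hg; have [O1 E1] := H1 _ _ O2; split=> // i j ij.
  by rewrite E1 ?E2 // mulrA.
Qed.

Lemma pop_ordge T a k g : pop T a -> a != 0 -> ordge k (T g) <-> ordge k g.
Proof.
move=> pT a0; split=> H; last by case: (pop_lead pT H).
elim: k H => [|k IH] H //.
have Hk := IH (ordgeW (leqnSn k) H) => i j.
rewrite ltnS leq_eqVlt => /orP [/eqP ij|]; last exact: Hk.
have [_ /(_ _ _ ij) /eqP] := pop_lead pT Hk.
rewrite H ?ij // eq_sym mulf_eq0 (negPf a0) /= => /eqP; exact.
Qed.

(* [vXY q] is the pair of values of the two local coordinates at the base point
   of [q] under the valuation of [q]; [emult q] is their minimum, that is the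
   multiplicity at that base point of a generic curvette of [q]. *)
Fixpoint vXY q : nat * nat :=
  match q with
  | [::] => (1, 1)%N
  | Some c :: q' => let: (x, y) := vXY q' in (x, x + (if c == 0%R then y else 0))%N
  | None :: q' => let: (x, y) := vXY q' in (x + y, y)%N
  end.

Definition emult q : nat :=
  match q with
  | [::] => 1
  | Some _ :: q' => (vXY q').1
  | None :: q' => (vXY q').2
  end.

Lemma vXY_gt0 q : (0 < (vXY q).1)%N && (0 < (vXY q).2)%N.
Proof. by elim: q => [|[c|] q] //=; case: (vXY q) => x y /= /andP [? ?]; lia. Qed.

Lemma emult_gt0 q : (0 < emult q)%N.
Proof. by case: q => [|[c|] q] //=; case/andP: (vXY_gt0 q). Qed.

Lemma emult_le q : (emult q <= (vXY q).1)%N && (emult q <= (vXY q).2)%N.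
Proof. by case: q => [|[c|] q] //=; case: (vXY q) => x y /=; lia. Qed.

Lemma emult_cons d q : (emult q <= emult (d :: q))%N.
Proof. by case/andP: (emult_le q); case: d. Qed.

Lemma iter_mulX_ordge n k g : ordge k (iter n mulX g) <-> ordge (k - n) g.
Proof.
elim: n k => [|n IH] k; first by rewrite subn0.
rewrite iterS subnS -subn1 subnAC -IH subn1; split=> H.
  by move=> i j ij; have := H i.+1 j; apply; lia.
by move=> [|i] j ij //=; apply: H; lia.
Qed.

Lemma iter_mulY_ordge n k g : ordge k (iter n mulY g) <-> ordge (k - n) g.
Proof.
elim: n k => [|n IH] k; first by rewrite subn0.
rewrite iterS subnS -subn1 subnAC -IH subn1; split=> H.
  by move=> i j ij; have := H i j.+1; apply; lia.
by move=> i [|j] ij //=; apply: H; lia.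
Qed.

Lemma iter_mulXY n m g : iter n mulX (iter m mulY g) = iter m mulY (iter n mulX g).
Proof.
have XY k h : mulX (iter k mulY h) = iter k mulY (mulX h).
  by elim: k => //= k IH; rewrite mulXY IH.
by elim: n => //= n ->; rewrite XY.
Qed.

Lemma stepT_iter_mulX c n g :
  stepT (Some c) (iter n mulX g) = iter n mulX (stepT (Some c) g).
Proof. by elim: n => //= n IH; rewrite stepT_mulX IH. Qed.

Lemma stepT_iter_mulY c n g : stepT (Some c) (iter n mulY g) =
  iter n mulX (iter n (fun h => mulY h + c *: h) (stepT (Some c) g)).
Proof.
have XS k h : iter k mulX (mulY h + c *: h) =
    mulY (iter k mulX h) + c *: iter k mulX h.
  by elim: k => // k IH; rewrite !iterS IH linearD linearZ /= mulXY.
elim: n => // n IH.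
by rewrite [iter n.+1 _ (stepT _ _)]iterS !iterS stepT_mulY IH XS.
Qed.

Lemma stepT_none_iter_mulX n g : stepT None (iter n mulX g) =
  iter n mulX (iter n mulY (stepT None g)).
Proof.
elim: n => // n IH; rewrite [iter n.+1 mulY _]iterS !iterS stepT_none_mulX IH.
by rewrite -[mulY (iter n mulX _)]/(iter 1 mulY _) -iter_mulXY.
Qed.

Lemma stepT_none_iter_mulY n g :
  stepT None (iter n mulY g) = iter n mulY (stepT None g).
Proof. by elim: n => //= n IH; rewrite stepT_none_mulY IH. Qed.

Lemma pop_iter T a n : pop T a -> pop (iter n T) (a ^+ n).
Proof.
move=> pT; elim: n => [|n IH]; first exact: pop_id.
by rewrite exprS; exact: pop_comp pT IH.
Qed.

(** Monomials add their own value to that of [g]. The multiplier [T] is there for the induction: at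
    a direction [c] other than 0 the pull-back of [y] is [u (v + c)], whose second factor is a
    unit. *)
Lemma pull_monomial q T a i j k g : pop T a -> a != 0 ->
  ordge k (pull q (iter i mulX (iter j mulY (T g)))) <->
  ordge (k - (i * (vXY q).1 + j * (vXY q).2)) (pull q g).
Proof.
elim: q T a i j g => [|d q IH] T a i j g pT a0.
  rewrite /= iter_mulX_ordge iter_mulY_ordge (pop_ordge _ _ pT a0).
  by rewrite -subnDA !muln1.
rewrite !pull_cons; have [T' pT' HT'] := pop_stepT d pT.
case: d HT' => [c|] HT' /=; last first.
  rewrite stepT_none_iter_mulX stepT_none_iter_mulY HT' -iterD.
  rewrite (IH _ _ _ _ _ pT' a0); case: (vXY q) => x y /=.
  by have -> : (i * x + (i + j) * y = i * (x + y) + j * y)%N by lia.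
rewrite stepT_iter_mulX stepT_iter_mulY HT' -iterD.
case: (vXY q) IH => x y IH; case: eqP => c0.
  have -> : (fun h => mulY h + c *: h) = mulY.
    by apply: funext => h; rewrite c0 scale0r addr0.
  rewrite (IH _ _ _ _ _ pT' a0) /=.
  by have -> : ((i + j) * x + j * y = i * x + j * (x + y))%N by lia.
have pU : pop (fun h => mulY h + c *: h) c.
  by rewrite -[X in pop _ X]add0r; exact: pop_add pop_Y (pop_scale c).
have c1 : c ^+ j * a != 0 by rewrite mulf_neq0 // expf_neq0 //; apply/eqP.
have := IH _ _ (i + j)%N 0%N (stepT (Some c) g) (pop_comp (pop_iter j pU) pT') c1.
by move=> /= ->; have -> : ((i + j) * x + 0 * y = i * x + j * (x + 0))%N by lia.
Qed.

Lemma pull_mulX q k g : ordge k (pull q (mulX g)) <-> ordge (k - (vXY q).1) (pull q g).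
Proof.
by have := pull_monomial q 1 0 k g pop_id (oner_neq0 _); rewrite mul1n mul0n addn0.
Qed.

Lemma pull_mulY q k g : ordge k (pull q (mulY g)) <-> ordge (k - (vXY q).2) (pull q g).
Proof.
by have := pull_monomial q 0 1 k g pop_id (oner_neq0 _); rewrite mul1n mul0n add0n.
Qed.

End Charts.

(** * Transforms along an exceptional line *)

Section Transform.
Variable R : realType.
Implicit Types (f g : series R) (d : dir R) (p q : ipt R).

(* In the chart of the direction [None] the exceptional line is [v = 0]; swapping
   the coordinates makes it [u = 0], as in the other charts. *)
Definition orient d f : series R := if d is None then fun a b => f b a else f.

(* The transform of [f] at [d], divided by the [k]-th power of the equation of the
   exceptional line. *)
Definition transf d k f : series R := fun a b => orient d (stepT d f) (a + k)%N b.

(** The restriction of [g] to the line [u = 0] vanishes to order at least [s] at the origin. *)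
Definition rowge s g := forall b, (b < s)%N -> g 0%N b = 0.

Lemma orientK d : involutive (orient d).
Proof. by case: d. Qed.

Lemma orient_linear d : linear (orient d).
Proof. by case: d. Qed.
HB.instance Definition _ d := GRing.isLinear.Build _ _ _ _ (orient d) (orient_linear d).

Lemma orient_ordge d n f : ordge n (orient d f) <-> ordge n f.
Proof. by case: d => [c|] //; split=> H a b ab; apply: H; rewrite addnC. Qed.

Lemma transf_linear d k : linear (transf d k).
Proof. by move=> c f g; apply: seriesP => a b; rewrite /transf stepT_linear orient_linear. Qed.
HB.instance Definition _ d k :=
  GRing.isLinear.Build _ _ _ _ (transf d k) (transf_linear d k).

Lemma transf_some c k f a b :
  transf (Some c) k f a b = (hform (a + k) f \Po ('X + c%:P))`_b.
Proof. exact: stepT_some. Qed.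

Lemma transf_none k f a b :
  transf None k f a b = if (b <= a + k)%N then (hform (a + k) f)`_(a + k - b) else 0.
Proof. exact: stepT_none. Qed.

Lemma transf_mulX d k f : ordge k.+1 f -> transf d k f = mulX (transf d k.+1 f).
Proof.
move=> /ordge_hform Hf; apply: seriesP => -[|a] b /=; last first.
  by rewrite /transf addSnnS.
case: d => [c|]; first by rewrite transf_some add0n Hf // comp_poly0 coef0.
by rewrite transf_none add0n Hf // coef0 if_same.
Qed.

Lemma stepT_transf d k f : ordge k f ->
  stepT d f = orient d (iter k (@mulX R) (transf d k f)).
Proof.
elim: k => [|k IH] Hf.
  have -> : transf d 0 f = orient d (stepT d f).
    by apply: seriesP => a b; rewrite /transf addn0.
  by rewrite orientK.
have Hf' : ordge k f by apply: ordgeW Hf.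
by rewrite IH // (transf_mulX _ Hf) -iterSr.
Qed.

Lemma comp_translate_lowcoef (K : fieldType) (c : K) (h : {poly K}) s :
  (forall b, (b < s)%N -> (h \Po ('X + c%:P))`_b = 0) ->
  (('X - c%:P) ^+ s %| h)%R.
Proof.
move=> Hh; set g := h \Po _ in Hh.
have /dvdpP [w Hw] : 'X^s %| g.
  rewrite -[g](poly_take_drop s).
  have -> : take_poly s g = 0; last by rewrite add0r dvdp_mull.
  by apply/polyP => i; rewrite coef_take_poly coef0; case: ifP => // /Hh.
have -> : h = g \Po ('X - c%:P).
  by rewrite /g -comp_polyA comp_polyD comp_polyX comp_polyC subrK comp_polyXr.
by rewrite Hw comp_polyM comp_Xn_poly dvdp_mull.
Qed.

(** Row 0 of the transform is the form of degree [n] on the exceptional projective line, where it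
    has at most [n] zeros; [s1] and [s2] are bounded by its multiplicities at two distinct
    points. *)
Lemma rowge_transf_bound d1 d2 n f s1 s2 : d1 != d2 -> hform n f != 0 ->
  rowge s1 (transf d1 n f) -> rowge s2 (transf d2 n f) -> (s1 + s2 <= n)%N.
Proof.
have some_none c s1' s2' : hform n f != 0 ->
    rowge s1' (transf (Some c) n f) -> rowge s2' (transf None n f) ->
    (s1' + s2' <= n)%N.
  move=> f0 H1 H2.
  have dv : ('X - c%:P) ^+ s1' %| hform n f.
    by apply: comp_translate_lowcoef => b bs; rewrite -[RHS](H1 b bs) transf_some.
  have /(dvdp_leq f0) : ('X - c%:P) ^+ s1' %| hform n f by [].
  rewrite size_exp_XsubC => ls.
  (* The direction [None] is the point at infinity: zeros there lower the degree. *)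
  have sz : (size (hform n f) <= n.+1 - s2')%N.
    apply/leq_sizeP => j jn; rewrite hformE; case: leqP => // jn'.
    have := H2 (n - j)%N; rewrite transf_none add0n leq_subr subKn // hformE jn'.
    by apply; lia.
  by have := leq_trans ls sz; lia.
case: d1 d2 => [c1|] [c2|] // nd f0 H1 H2; [|exact: some_none H1 H2|]; last first.
  by rewrite addnC; exact: some_none H2 H1.
have : ('X - c1%:P) ^+ s1 * ('X - c2%:P) ^+ s2 %| hform n f.
  rewrite Gauss_dvdp; last first.
    apply/coprimep_expl/coprimep_expr; rewrite coprimep_XsubC root_XsubC.
    by apply: contra nd => /eqP ->.
  apply/andP; split; apply: comp_translate_lowcoef => b bs.
    by rewrite -[RHS](H1 b bs) transf_some.
  by rewrite -[RHS](H2 b bs) transf_some.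
move=> /(dvdp_leq f0); rewrite size_mul ?expf_neq0 ?polyXsubC_eq0 //.
rewrite !size_exp_XsubC => /leq_trans /(_ (size_hform _ _)); lia.
Qed.

Definition homog k (h : {poly R[i]}) : series R :=
  fun i j => if (i + j == k)%N then h`_j else 0.

Lemma homog_ordge k h : ordge k (homog k h).
Proof. by move=> a b ab; rewrite /homog ltn_eqF. Qed.

Lemma hform_homog k (h : {poly R[i]}) : (size h <= k.+1)%N -> hform k (homog k h) = h.
Proof.
move=> sh; apply/polyP => j; rewrite hformE /homog; case: leqP => jk.
  by rewrite subnK // eqxx.
by rewrite nth_default // (leq_trans sh).
Qed.

Lemma transf_form_some c k (h : {poly R[i]}) b : (size h <= k.+1)%N ->
  transf (Some c) k (homog k h) 0%N b = (h \Po ('X + c%:P))`_b.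
Proof. by move=> sh; rewrite transf_some add0n hform_homog. Qed.

Lemma transf_form_none k (h : {poly R[i]}) b : (size h <= k.+1)%N ->
  transf None k (homog k h) 0%N b = if (b <= k)%N then h`_(k - b) else 0.
Proof. by move=> sh; rewrite transf_none add0n hform_homog. Qed.

(* The forms [l1 ^ a * l2 ^ (k - a)], with [li] the line of direction [di]. *)
Lemma separating_hform d1 d2 k a : d1 != d2 -> (a <= k)%N ->
  exists F, [/\ ordge k F, rowge a (transf d1 k F), transf d1 k F 0%N a != 0
    & rowge (k - a) (transf d2 k F)].
Proof.
have XC (c c' : R[i]) : ('X - c%:P) \Po ('X + c'%:P) = 'X + (c' - c)%:P.
  by rewrite comp_polyB comp_polyX comp_polyC polyCB addrA.
have powlow (c c' : R[i]) b m h : c' = c -> (b < m)%N ->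
    ((('X - c%:P) ^+ m * h) \Po ('X + c'%:P))`_b = 0.
  move=> -> bm; rewrite comp_polyM rmorphXn /= XC subrr addr0.
  by rewrite coefXnM bm.
case: d1 d2 => [c1|] [c2|] // nd ak.
- have c12 : c1 - c2 != 0 by rewrite subr_eq0; apply: contra nd => /eqP ->.
  pose h := ('X - c1%:P) ^+ a * ('X - c2%:P) ^+ (k - a).
  have sh : (size h <= k.+1)%N.
    rewrite size_mul ?expf_neq0 ?polyXsubC_eq0 // !size_exp_XsubC; lia.
  exists (homog k h); split; first exact: homog_ordge.
  + by move=> b ba; rewrite transf_form_some // powlow.
  + rewrite transf_form_some // /h comp_polyM !rmorphXn /= !XC subrr addr0.
    rewrite coefXnM ltnn subnn -horner_coef0.
    by rewrite horner_exp !hornerE expf_neq0.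
  + by move=> b ba; rewrite transf_form_some // /h mulrC powlow.
- pose h := ('X - c1%:P) ^+ a.
  have sh' : size h = a.+1 by rewrite size_exp_XsubC.
  have sh : (size h <= k.+1)%N by rewrite sh'.
  exists (homog k h); split; first exact: homog_ordge.
  + by move=> b ba; rewrite transf_form_some // -[h]mulr1 powlow.
  + rewrite transf_form_some // rmorphXn /= XC subrr addr0.
    by rewrite coefXn eqxx oner_neq0.
  + move=> b ba; rewrite transf_form_none //; case: leqP => // bk.
    by rewrite nth_default // sh'; lia.
- pose h := ('X - c2%:P) ^+ (k - a).
  have sh' : size h = (k - a).+1 by rewrite size_exp_XsubC.
  have sh : (size h <= k.+1)%N by rewrite sh'; lia.
  exists (homog k h); split; first exact: homog_ordge.
  + move=> b ba; rewrite transf_form_none //; case: leqP => // bk.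
    by rewrite nth_default // sh'; lia.
  + rewrite transf_form_none // ak.
    have /monicP : h \is monic by rewrite monic_exp // monicXsubC.
    by rewrite lead_coefE sh' /= => ->; rewrite oner_neq0.
  + by move=> b ba; rewrite transf_form_some // -[h]mulr1 powlow.
Qed.

(* What the argument uses of the ideals, in the local ring of a point of the
   exceptional line [u = 0], that a family of valuations induces on the [k]-th
   power of the maximal ideal. *)
Record filtration (A : nat -> series R -> Prop) := Filtration {
  filt_lin : forall k, linset (A k);
  filt_mono : forall k g, A k g -> A k.+1 g;
  filt_mulX : forall k g, A k.+1 g -> A k (mulX g);
  filt_mulY : forall k g, A k g -> A k (mulY g);
  filt_ord : exists N, forall k g, ordge N g -> A k g;
  filt_full : exists N, forall g, A N g
}.

Lemma filt_le A k l g : filtration A -> (k <= l)%N -> A k g -> A l g.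
Proof.
move=> FA /subnK <-; elim: (l - k)%N => // n IH Ag.
by rewrite addSn; apply: filt_mono => //; exact: IH.
Qed.

(** Subtracting multiples [c v^(m - s) gs], which stay in [A k], clears the restriction to [u = 0]
    one coefficient at a time; from order [N] on the rest of it lies in [A k] by [filt_ord], and
    what remains is divisible by [u]. *)
Lemma filt_reduce A k gs s g : filtration A -> A k gs ->
  rowge s gs -> gs 0%N s != 0 -> rowge s g -> exists g', A k (g - mulX g').
Proof.
move=> FA Ags Hgs gs0; have [N HN] := filt_ord FA.
suff main t : forall m g, (N <= m + t)%N -> (s <= m)%N -> rowge m g ->
    exists g', A k (g - mulX g').
  by move=> Hg; apply: (main N s) => //; exact: leq_addl.
elim: t => [|t IH] m h Nm sm Hm.
  exists (fun a b => h a.+1 b); apply: HN => -[|a] b ab.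
    by rewrite seriesBE /= subr0; apply: Hm; lia.
  by rewrite seriesBE /= subrr.
pose c := h 0%N m / gs 0%N s.
pose h1 := iter (m - s) (@mulY R) gs.
have iterE n b : iter n (@mulY R) gs 0%N b =
    if (n <= b)%N then gs 0%N (b - n)%N else 0.
  elim: n b => [|n IHn] b; first by rewrite subn0.
  by case: b => [|b] //; rewrite iterS /= IHn subSS ltnS.
have Ah1 : A k h1.
  by rewrite /h1; elim: (m - s)%N => // n IHn; rewrite iterS; exact: filt_mulY.
have [||b|g' Hg'] := IH m.+1 (h - c *: h1).
- by rewrite addSnnS.
- exact: leqW.
- rewrite ltnS leq_eqVlt seriesBE seriesZE /h1 iterE => /orP [/eqP ->|bm].
    by rewrite leq_subr subKn // /c divfK // subrr.
  rewrite Hm //; case: leqP => bm'; last by rewrite mulr0 subr0.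
  by rewrite Hgs ?mulr0 ?subr0 //; lia.
exists g'; have -> : h - mulX g' = (h - c *: h1 - mulX g') + c *: h1.
  by rewrite addrAC subrK.
by apply: (linsetD (filt_lin FA k)) => //; exact: (linsetZ _ (filt_lin FA k)).
Qed.

(** * Surjectivity onto the local quotients at two points of the exceptional line *)

Section Surjectivity.
Variables (d1 d2 : dir R) (A B : nat -> series R -> Prop) (n : nat) (f0 : series R).
Hypotheses (nd : d1 != d2) (FA : filtration A) (FB : filtration B).
Hypothesis f0S : hform n f0 != 0.
Hypotheses (Af0 : A n (transf d1 n f0)) (Bf0 : B n (transf d2 n f0)).

Lemma exact_row d d' : d != d' ->
  exists2 s, rowge s (transf d n f0) & transf d n f0 0%N s != 0.
Proof.
move=> dd; have [|b Hb mb] := @ex_minnP (fun b => transf d n f0 0%N b != 0); last first.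
  exists b => // b' bb'; apply/eqP; apply: contraLR bb' => H.
  by rewrite -leqNgt; exact: mb.
apply: contrapT => H.
have : (n.+1 + 0 <= n)%N; last by rewrite addn0 ltnn.
apply: (@rowge_transf_bound d d' n f0) => // b _; apply/eqP/negPn/negP => Hb.
by apply: H; exists b.
Qed.

(** Descending induction on [k]: for large [k] both conditions are empty. Otherwise forms of degree
    [k] clear the coefficients below [s1] and [s2] on the exceptional line, members of the ideals
    clear the others, and the remaining multiples of [u] are handled in degree [k + 1]. There is
    room for the forms because [s1 + s2 <= n <= k]. *)
Lemma transf_pair_surj k g1 g2 : (n <= k)%N ->
  exists F, [/\ ordge k F, A k (g1 - transf d1 k F) & B k (g2 - transf d2 k F)].
Proof.
have [s1 R1 N1] := exact_row nd.
have [s2 R2 N2] : exists2 s, rowge s (transf d2 n f0) & transf d2 n f0 0%N s != 0.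
  by apply: (@exact_row d2 d1); rewrite eq_sym.
have s12 : (s1 + s2 <= n)%N := rowge_transf_bound nd f0S R1 R2.
have [NA HA] := filt_full FA; have [NB HB] := filt_full FB.
move=> nk; have [t Ht] : exists t, (NA + NB <= k + t)%N.
  by exists (NA + NB)%N; exact: leq_addl.
elim: t k nk g1 g2 Ht => [|t IH] k nk g1 g2 Ht.
  exists 0; split=> //.
  - by apply: (@filt_le A NA) => //; lia.
  - by apply: (@filt_le B NB) => //; lia.
have LA := filt_lin FA k; have LB := filt_lin FB k.
pose goal g1 g2 := exists F,
  [/\ ordge k F, A k (g1 - transf d1 k F) & B k (g2 - transf d2 k F)].
have shift F g1' g2' : ordge k F ->
    goal (g1' - transf d1 k F) (g2' - transf d2 k F) -> goal g1' g2'.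
  move=> HF [F' [HF' A' B']]; exists (F + F'); rewrite !linearD /= !addrA.
  by split=> //; exact: (linsetD (@ordge_linset R k) HF HF').
have base g1' g2' : rowge s1 g1' -> rowge s2 g2' -> goal g1' g2'.
  move=> H1 H2.
  have [h1 Ah1] := filt_reduce FA (filt_le FA nk Af0) R1 N1 H1.
  have [h2 Bh2] := filt_reduce FB (filt_le FB nk Bf0) R2 N2 H2.
  have [||F [HF AF BF]] := IH k.+1 _ h1 h2; [exact: leqW | by rewrite addSnnS |].
  exists F; split; first by apply: ordgeW HF.
    rewrite (transf_mulX _ HF).
    have -> : g1' - mulX (transf d1 k.+1 F) =
        (g1' - mulX h1) + mulX (h1 - transf d1 k.+1 F).
      by rewrite mulXB addrA subrK.
    by apply: linsetD => //; exact: filt_mulX.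
  rewrite (transf_mulX _ HF).
  have -> : g2' - mulX (transf d2 k.+1 F) =
      (g2' - mulX h2) + mulX (h2 - transf d2 k.+1 F).
    by rewrite mulXB addrA subrK.
  by apply: linsetD => //; exact: filt_mulX.
(* The coefficients of the second row from [s2 - t2] on are cleared upwards. The form used vanishes
   to order [k - a >= s1] at [d1], so the first row keeps its vanishing. *)
have kill2 t2 : forall g1' g2', rowge s1 g1' -> rowge (s2 - t2) g2' -> goal g1' g2'.
  elim: t2 => [|t2 IH2] g1' g2' H1 H2; first by apply: base; rewrite ?subn0 // in H2 *.
  case: (leqP s2 t2) => st; first by apply: IH2 => //; move=> b; lia.
  have nd' : d2 != d1 by rewrite eq_sym.
  pose a := (s2 - t2.+1)%N.
  have [|F [HF F2 F2n F1]] := @separating_hform d2 d1 k a nd'; first by rewrite /a; lia.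
  pose c := g2' 0%N a / transf d2 k F 0%N a.
  apply: (shift (c *: F)); first exact: (linsetZ c (@ordge_linset R k) HF).
  rewrite ![transf _ _ (c *: F)]linearZ /=; apply: IH2 => b bs.
    by rewrite seriesBE seriesZE H1 // F1 ?mulr0 ?subr0 // /a; lia.
  rewrite seriesBE seriesZE.
  have : (b <= a)%N by rewrite /a; lia.
  rewrite leq_eqVlt => /orP [/eqP ->|ba]; first by rewrite /c divfK // subrr.
  by rewrite H2 // F2 // mulr0 subr0.
(* The first row is treated before the second, so changes to the second row are harmless here. *)
have kill1 t1 : forall g1' g2', rowge (s1 - t1) g1' -> goal g1' g2'.
  elim: t1 => [|t1 IH1] g1' g2' H1.
    by apply: (kill2 s2); rewrite ?subn0 ?subnn // in H1 *.
  case: (leqP s1 t1) => st; first by apply: IH1 => //; move=> b; lia.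
  pose a := (s1 - t1.+1)%N.
  have [|F [HF F1 F1n F2]] := @separating_hform d1 d2 k a nd; first by rewrite /a; lia.
  pose c := g1' 0%N a / transf d1 k F 0%N a.
  apply: (shift (c *: F)); first exact: (linsetZ c (@ordge_linset R k) HF).
  rewrite ![transf _ _ (c *: F)]linearZ /=; apply: IH1 => b bs; rewrite seriesBE seriesZE.
  have : (b <= a)%N by rewrite /a; lia.
  rewrite leq_eqVlt => /orP [/eqP ->|ba]; first by rewrite /c divfK // subrr.
  by rewrite H1 // F1 // mulr0 subr0.
by apply: (kill1 s1); rewrite subnn.
Qed.

End Surjectivity.

End Transform.

(** * Codimension of valuation ideals under one blow-up *)

Section Family.
Variable R : realType.
Implicit Types (f g : series R) (d : dir R) (p q : ipt R) (F : seq (ipt R * nat)).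

(** The order at [p] of the pull-back of [f] is the multiplicity along [E_p], so these are the
    valuation ideals, taken in formal series; convergence is dealt with afterwards. *)
Definition Jfam F f := forall pw, pw \in F -> ordge pw.2 (pull pw.1 f).

(** The conditions induced at [d] after division by the [n]-th power of the equation of the
    exceptional line, whose value under [d :: q] is [emult (d :: q)]. *)
Definition child F d n : seq (ipt R * nat) :=
  [seq (behead pw.1, pw.2 - n * emult pw.1)%N | pw <- F & ohead pw.1 == Some d].

Definition filtr F d k g := Jfam (child F d k) (orient d g).

Definition maxw F := \max_(pw <- F) pw.2.

Lemma maxwP F pw : pw \in F -> (pw.2 <= maxw F)%N.
Proof. by move=> pwF; rewrite /maxw (big_rem pw) //= leq_maxl. Qed.

Lemma childP F d n f : Jfam (child F d n) f <-> forall q w, (d :: q, w) \in F ->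
  ordge (w - n * emult (d :: q)) (pull q f).
Proof.
split=> [H q w qF|H pw /mapP [[p w]]].
  apply: (H (q, w - n * emult (d :: q))%N); apply/mapP.
  by exists (d :: q, w); rewrite // mem_filter /= eqxx.
rewrite mem_filter => /andP [/= /eqP hp pF] ->; case: p hp pF => //= d' q [->] pF.
exact: H.
Qed.

Lemma Jfam_linset F : linset (Jfam F).
Proof.
split=> [pw _|c f g Hf Hg pw pwF]; first by rewrite pull0.
by rewrite pull_linear; case: (@ordge_linset R pw.2) => _; apply; [exact: Hf|exact: Hg].
Qed.

Lemma orient_mulX d g :
  orient d (mulX g) = if d is None then mulY (orient d g) else mulX (orient d g).
Proof. by case: d. Qed.

Lemma orient_mulY d g :
  orient d (mulY g) = if d is None then mulX (orient d g) else mulY (orient d g).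
Proof. by case: d. Qed.

Lemma pull_orient_mulX d q k g : ordge k (pull q (orient d (mulX g))) <->
  ordge (k - emult (d :: q)) (pull q (orient d g)).
Proof. by rewrite orient_mulX; case: d => [c|]; rewrite ?pull_mulX ?pull_mulY. Qed.

Lemma pull_orient_iter_mulX d q n k g :
  ordge k (pull q (orient d (iter n (@mulX R) g))) <->
  ordge (k - n * emult (d :: q)) (pull q (orient d g)).
Proof.
elim: n k => [|n IH] k; first by rewrite mul0n subn0.
by rewrite iterS pull_orient_mulX IH mulSn subnDA.
Qed.

Lemma filtr_filtration F d : filtration (filtr F d).
Proof.
split.
- move=> k; rewrite /filtr; split.
    have -> : orient d (0 : series R) = 0 by case: d.
    by case: (Jfam_linset (child F d k)).
  by move=> c f g Hf Hg; rewrite orient_linear; case: (Jfam_linset (child F d k)) => _; apply.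
- move=> k g /childP H; apply/childP => q w /H; apply: ordgeW.
  by rewrite mulSn; lia.
- move=> k g /childP H; apply/childP => q w /H Hg.
  by apply/pull_orient_mulX; rewrite -subnDA addnC -mulSn.
- move=> k g /childP H; apply/childP => q w /H Hg; rewrite orient_mulY.
  case: d {H} Hg => [c|] Hg; [apply/pull_mulY | apply/pull_mulX];
    by apply: ordgeW Hg; exact: leq_subr.
- exists (maxw F) => k g Hg; apply/childP => q w qF.
  apply/pull_ordge/orient_ordge; apply: ordgeW Hg.
  exact: leq_trans (leq_subr _ _) (maxwP qF).
- exists (maxw F) => g; apply/childP => q w qF.
  have -> : (w - maxw F * emult (d :: q) = 0)%N; last exact: ordge0.
  apply/eqP; rewrite subn_eq0; apply: leq_trans (maxwP qF) _.
  by rewrite leq_pmulr // emult_gt0.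
Qed.

(** Two directions suffice, since the families that get blown up have at most two members. *)
Definition covers F d1 d2 := forall p w, (p, w) \in F ->
  [\/ p = [::], ohead p = Some d1 | ohead p = Some d2].

Definition root_bound F n := forall w, ([::], w) \in F -> (w <= n)%N.

Lemma Jfam_transf F d1 d2 n f : covers F d1 d2 -> root_bound F n -> ordge n f ->
  Jfam F f <-> filtr F d1 n (transf d1 n f) /\ filtr F d2 n (transf d2 n f).
Proof.
move=> cF bF Hf.
have key d q w : ordge w (pull (d :: q) f) <->
    ordge (w - n * emult (d :: q)) (pull q (orient d (transf d n f))).
  by rewrite pull_cons (stepT_transf d Hf) pull_orient_iter_mulX.
split=> [H|[/childP H1 /childP H2] [p w] pF].
  by split; apply/childP => q w qF; apply/key; exact: (H _ qF).
case: p pF => [|d q] pF /=; first by apply: ordgeW Hf; exact: bF.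
apply/key; case: (cF _ _ pF) => //= -[dd]; rewrite -dd in H1 H2 *.
- exact: H1.
- exact: H2.
Qed.

Definition tri n := (\sum_(t < n) t.+1)%N.

Lemma cod_ordge n : cod (@ordge R n) (tri n).
Proof.
elim: n => [|n IH].
  rewrite /tri big_ord0; exists (\0 : {linear series R -> 'rV[R[i]]_0}); split=> [f|c].
    by split=> // _; exact: ordge0.
  by exists 0; apply/rowP => -[].
rewrite /tri big_ord_recr /= -/(tri n).
pose psi f : 'rV[R[i]]_n.+1 := \row_(j < n.+1) f (n - j)%N j.
have linP : linear psi by move=> a f g; apply/rowP => j; rewrite !mxE.
pose L := HB.pack_for {linear series R -> 'rV[R[i]]_n.+1} psi
  (GRing.isLinear.Build _ _ _ _ psi linP).
apply: (@cod_ext _ _ _ _ _ _ L IH) => [f|c].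
  change (ordge n.+1 f <-> ordge n f /\ psi f = 0); split=> [H|[H /rowP Hp] a b].
    split; first exact: ordgeW H.
    by apply/rowP => j; rewrite !mxE; apply: H; have := ltn_ord j; lia.
  rewrite ltnS leq_eqVlt => /orP [/eqP ab|]; last exact: H.
  have bn : (b < n.+1)%N by lia.
  by have := Hp (Ordinal bn); rewrite !mxE /=; have -> : (n - b = a)%N by lia.
exists (homog n (\poly_(j < n.+1) c 0 (inord j))); first exact: homog_ordge.
apply/rowP => j; rewrite !mxE /homog subnK -1?ltnS // eqxx coef_poly ltn_ord.
by rewrite inord_val.
Qed.

Lemma cod_orient d J m : cod J m -> cod (fun g => J (orient d g)) m.
Proof.
move=> [phi [kphi sphi]].
exists (phi \o orient d : {linear series R -> 'rV[R[i]]_m}).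
split=> [f|c]; first exact: kphi.
by have [f Hf] := sphi c; exists (orient d f); rewrite /= orientK.
Qed.

Lemma Jfam_ordge F f : ordge (maxw F) f -> Jfam F f.
Proof.
by move=> Hf pw pwF; apply: pull_ordge; apply: ordgeW Hf; exact: maxwP.
Qed.

Lemma cod_Jfam F : exists m, cod (Jfam F) m.
Proof. exact: cod_exists (Jfam_linset F) (cod_ordge _) (@Jfam_ordge F). Qed.

Lemma cod_full (J : series R -> Prop) m : cod J m -> (forall f, J f) -> m = 0%N.
Proof.
move=> cJ HJ; apply/eqP; rewrite -leqn0.
by apply: (cod_le_ker (Phi := (\0 : {linear series R -> 'rV[R[i]]_0})) cJ).
Qed.

Lemma rowpair_linear d1 d2 n m1 m2 (phi1 : {linear series R -> 'rV[R[i]]_m1})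
  (phi2 : {linear series R -> 'rV[R[i]]_m2}) :
  linear (fun f => row_mx (phi1 (transf d1 n f)) (phi2 (transf d2 n f))).
Proof.
move=> a f g; rewrite !transf_linear (linearP phi1) (linearP phi2) /=.
by rewrite scale_row_mx add_row_mx.
Qed.

(** A series of order at least [n] whose two transforms lie in the induced ideals belongs to the
    ideal, and these are [tri n + (m1 + m2)] linear conditions. *)
Lemma blowup_upper F d1 d2 n m m1 m2 : covers F d1 d2 -> root_bound F n ->
  cod (Jfam (child F d1 n)) m1 -> cod (Jfam (child F d2 n)) m2 ->
  cod (Jfam F) m -> (m <= tri n + (m1 + m2))%N.
Proof.
move=> cF bF /(cod_orient d1) [phi1 [k1 _]] /(cod_orient d2) [phi2 [k2 _]] cm.
have [phi [k _]] := cod_ordge n.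
pose Phi f := row_mx (phi f) (row_mx (phi1 (transf d1 n f)) (phi2 (transf d2 n f))).
have linP : linear Phi.
  move=> a f g; rewrite /Phi; have -> := rowpair_linear d1 d2 n phi1 phi2 a f g.
  by rewrite (linearP phi) /= [X in _ = X + _]scale_row_mx [RHS]add_row_mx.
pose L := HB.pack_for {linear series R -> 'rV[R[i]]_(tri n + (m1 + m2))} Phi
  (GRing.isLinear.Build _ _ _ _ Phi linP).
apply: (cod_le_ker (Phi := L) cm) => f.
change (Phi f = 0 -> Jfam F f); rewrite /Phi -row_mx0 => /eq_row_mx [/k Hf].
rewrite -row_mx0 => /eq_row_mx [/k1 H1 /k2 H2].
by apply/(Jfam_transf cF bF Hf).
Qed.

(* The order [n] of the ideal makes the map from the [n]-th power of the maximal
   ideal to the local quotients surjective, so here the upper bound is attained. *)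
Lemma blowup_exact F d1 d2 : d1 != d2 -> covers F d1 d2 ->
  exists n m1 m2, [/\ root_bound F n, cod (Jfam (child F d1 n)) m1,
    cod (Jfam (child F d2 n)) m2 & cod (Jfam F) (tri n + (m1 + m2))].
Proof.
move=> nd cF.
pose Q n := `[< exists2 f, Jfam F f & hform n f != 0 >].
have exQ : exists n, Q n.
  exists (maxw F); apply/asboolP; exists (homog (maxw F) 1).
    exact/Jfam_ordge/homog_ordge.
  by rewrite hform_homog ?oner_neq0 // size_poly1.
case: (ex_minnP exQ) => n /asboolP [f0 Jf0 f0S] minn.
have ordn f : Jfam F f -> ordge n f.
  move=> Jf; apply/ordge_hform => k kn; apply/eqP/negPn/negP => fk.
  have : Q k by apply/asboolP; exists f.
  by move=> /minn; rewrite leqNgt kn.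
have bF : root_bound F n.
  move=> w wF; rewrite leqNgt; apply/negP => nw; move/negP: f0S; apply.
  by have /ordge_hform -> := Jf0 _ wF.
have [Af0 Bf0] := (Jfam_transf cF bF (ordn _ Jf0)).1 Jf0.
have [m1 c1] := cod_Jfam (child F d1 n); have [m2 c2] := cod_Jfam (child F d2 n).
exists n, m1, m2; split=> //.
have [phi1 [k1 s1]] := cod_orient d1 c1; have [phi2 [k2 s2]] := cod_orient d2 c2.
pose L := HB.pack_for {linear series R -> 'rV[R[i]]_(m1 + m2)}
  (fun f => row_mx (phi1 (transf d1 n f)) (phi2 (transf d2 n f)))
  (GRing.isLinear.Build _ _ _ _
    (fun f => row_mx (phi1 (transf d1 n f)) (phi2 (transf d2 n f)))
    (rowpair_linear d1 d2 n phi1 phi2)).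
apply: (@cod_ext _ _ _ _ _ _ L (cod_ordge n)) => [f|c].
  change (Jfam F f <-> ordge n f /\
    row_mx (phi1 (transf d1 n f)) (phi2 (transf d2 n f)) = 0).
  split=> [Jf|[Hf]].
    have Hf := ordn _ Jf; split=> //.
    have [/k1 -> /k2 ->] := (Jfam_transf cF bF Hf).1 Jf.
    exact: row_mx0.
  rewrite -row_mx0 => /eq_row_mx [/k1 H1 /k2 H2].
  by apply/(Jfam_transf cF bF Hf).
have [g1 Hg1] := s1 (lsubmx c); have [g2 Hg2] := s2 (rsubmx c).
have [f [Hf /k1 H1 /k2 H2]] := transf_pair_surj nd (filtr_filtration F d1)
  (filtr_filtration F d2) f0S Af0 Bf0 g1 g2 (leqnn n).
exists f => //; change (row_mx (phi1 (transf d1 n f)) (phi2 (transf d2 n f)) = c).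
move: H1 H2; rewrite (linearB phi1) (linearB phi2) Hg1 Hg2 => /eqP + /eqP.
by rewrite !subr_eq0 => /eqP <- /eqP <-; exact: hsubmxK.
Qed.

End Family.

(** * The Legendre transform of the codimension function *)

Section Legendre.
Variable R : realType.
Implicit Types (p q : ipt R) (a b : nat).

(* [legG b x] is the maximum over [n] of [n * x - b * n * (n + 1) / 2]. *)
Definition legG b x := (\sum_(t < x) (x - b * t.+1))%N.

(** [n x - b n (n + 1) / 2] is the sum over [t < n] of [x - b (t + 1)]. Truncating the terms at 0
    and summing over all of them can only increase it, and those with [t >= x] are 0. *)
Lemma legG_ge b x n : (0 < b)%N -> (n * x <= b * tri n + legG b x)%N.
Proof.
move=> b0; have zero t : (x <= t)%N -> (x - b * t.+1 = 0)%N by nia.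
have le : (\sum_(t < n) (x - b * t.+1) <= legG b x)%N.
  rewrite /legG; case: (leqP n x) => nx.
    rewrite -[leqRHS](big_mkord xpredT (fun t => x - b * t.+1)%N).
    by rewrite (@big_cat_nat _ _ _ n) //= big_mkord leq_addr.
  rewrite -[leqLHS](big_mkord xpredT (fun t => x - b * t.+1)%N).
  rewrite (@big_cat_nat _ _ _ x) //=; last exact: ltnW.
  rewrite big_mkord big_nat_cond.
  by rewrite [X in (_ + X)%N]big1 ?addn0 // => t /andP [/andP [/zero]].
apply: leq_trans (leq_add (leqnn _) le).
rewrite /tri big_distrr /= -big_split /= -[leqLHS]/(n * x)%N.
have {1}-> : (n * x = \sum_(t < n) x)%N by rewrite sum_nat_const card_ord.
by apply: leq_sum => t _; lia.
Qed.

(** The maximum is reached at [x %/ b], the number of terms with [b (t + 1) <= x]. *)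
Lemma legG_le b x : (0 < b)%N -> (b * tri (x %/ b) + legG b x <= (x %/ b) * x)%N.
Proof.
move=> b0; set n := (x %/ b)%N; have nx : (n <= x)%N by exact: leq_div.
have dv := divn_eq x b; have lt := ltn_pmod x b0; rewrite -/n in dv.
have -> : legG b x = (\sum_(t < n) (x - b * t.+1))%N.
  rewrite /legG -[LHS](big_mkord xpredT (fun t => x - b * t.+1)%N).
  rewrite (@big_cat_nat _ _ _ n) //= big_mkord big_nat_cond.
  rewrite [X in (_ + X)%N]big1 ?addn0 // => t /andP [/andP [nt _] _].
  by nia.
rewrite /tri big_distrr /= -big_split /=.
have -> : (n * x = \sum_(t < n) x)%N by rewrite sum_nat_const card_ord.
by apply: leq_sum => t _; have := ltn_ord t; nia.
Qed.

Definition legS a b (s : seq nat) := (\sum_(x <- s) legG b (a * x))%N.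

Fixpoint emults p : seq nat :=
  emult p :: (if p is _ :: q then emults q else [::]).

(** Multiplicities of the union of two generic curvettes at the points of both chains: added at
    common points, listed separately once the chains part. *)
Fixpoint emults2 p1 p2 : seq nat :=
  (emult p1 + emult p2)%N ::
  match p1, p2 with
  | d1 :: q1, d2 :: q2 =>
      if d1 == d2 then emults2 q1 q2 else emults q1 ++ emults q2
  | _ :: q1, [::] => emults q1
  | [::], _ :: q2 => emults q2
  | [::], [::] => [::]
  end.

Lemma legS_cons a b x s : legS a b (x :: s) = (legG b (a * x) + legS a b s)%N.
Proof. by rewrite /legS big_cons. Qed.

Lemma legS_nil a b : legS a b [::] = 0%N.
Proof. by rewrite /legS big_nil. Qed.

Lemma legS_cat a b s t : legS a b (s ++ t) = (legS a b s + legS a b t)%N.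
Proof. by rewrite /legS big_cat. Qed.

(** A second direction for the blow-up lemmas when the family uses only one; the ideal induced there
    is the whole ring. *)
Definition other (d : dir R) : dir R := if d is None then Some 0 else None.

Lemma neq_other d : d != other d. Proof. by case: d. Qed.

Lemma child1 d q w n : child [:: (d :: q, w)] d n = [:: (q, w - n * emult (d :: q))%N].
Proof. by rewrite /child /= eqxx. Qed.

Lemma child1_neq p w d n : ohead p != Some d -> child [:: (p, w)] d n = [::].
Proof. by rewrite /child /= => /negPf ->. Qed.

Lemma child2 p1 w1 p2 w2 d n : child [:: (p1, w1); (p2, w2)] d n =
  child [:: (p1, w1)] d n ++ child [:: (p2, w2)] d n.
Proof. by rewrite /child -map_cat -filter_cat. Qed.

Lemma cod_nil m : cod (@Jfam R [::]) m -> m = 0%N.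
Proof. by move=> c; apply: (cod_full c). Qed.

Lemma cod_nil0 : cod (@Jfam R [::]) 0.
Proof. by have [m c] := cod_Jfam ([::] : seq (ipt R * nat)); rewrite -(cod_nil c). Qed.

(** Induction along the chain. At the order [n] of the ideal the codimension splits exactly, and
    [w <= n e + (w - n e)] splits [a w] into a term bounded by [legG_ge] and one for the rest of the
    chain. *)
Lemma single_lower a b p w m : (0 < b)%N -> cod (Jfam [:: (p, w)]) m ->
  (a * w <= b * m + legS a b (emults p))%N.
Proof.
move=> b0; elim: p w m => [|d q IH] w m cm.
  have [||n [m1 [m2 [bF /cod_nil c1 /cod_nil c2 c]]]] :=
      @blowup_exact R [:: ([::], w)] None (Some 0) => //.
    by move=> p w'; rewrite inE => /eqP [-> _]; constructor 1.
  have wn : (w <= n)%N by apply: bF; rewrite inE.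
  rewrite (cod_uniq cm c) // c1 c2 legS_cons legS_nil muln1 !addn0.
  apply: leq_trans (legG_ge a n b0); rewrite mulnC.
  by rewrite leq_mul2r wn orbT.
have [||n [m1 [m2 [bF c1 c2 c]]]] :=
    @blowup_exact R [:: (d :: q, w)] d (other d) => //; first exact: neq_other.
  by move=> p w'; rewrite inE => /eqP [-> _]; constructor 2.
move: c1 c2; rewrite child1 child1_neq; last by rewrite /= (inj_eq Some_inj) neq_other.
move=> /IH c1 /cod_nil c2; rewrite (cod_uniq cm c) // c2 addn0 legS_cons.
have := legG_ge (a * emult (d :: q)) n b0.
set e := emult _ in c1 *.
have : (a * w <= a * (n * e) + a * (w - n * e))%N by rewrite -mulnDr leq_mul2l; lia.
by rewrite -/emults; lia.
Qed.

(** The bound is attained: at each point take the maximiser [n = (a e) %/ b] and let [w] be [n e]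
    plus the value found for the rest. The inequality [blowup_upper] suffices here. *)
Lemma single_upper a b p : (0 < b)%N -> exists w m,
  cod (Jfam [:: (p, w)]) m /\ (b * m + legS a b (emults p) <= a * w)%N.
Proof.
move=> b0; elim: p => [|d q [w' [m' [cm' IH]]]].
  pose n := (a %/ b)%N; exists n; have [m cm] := cod_Jfam [:: ([::] : ipt R, n)].
  exists m; split=> //.
  have := @blowup_upper R [:: ([::], n)] None (Some 0) n m 0 0.
  move=> /(_ _ _ cod_nil0 cod_nil0 cm) le.
  have {}le : (m <= tri n)%N.
    rewrite -[tri n]addn0; apply: le => [p w'|w']; rewrite inE => /eqP [].
      by move=> -> _; constructor 1.
    by move=> ->.
  rewrite legS_cons legS_nil muln1 addn0 [leqRHS]mulnC.
  apply: leq_trans (legG_le a b0); rewrite leq_add2r leq_mul2l.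
  by rewrite le orbT.
set e := emult (d :: q); pose n := ((a * e) %/ b)%N.
exists (n * e + w')%N; have [m cm] := cod_Jfam [:: (d :: q, n * e + w')%N].
exists m; split=> //.
have := @blowup_upper R [:: (d :: q, n * e + w')%N] d (other d) n m m' 0.
rewrite child1 child1_neq; last by rewrite /= (inj_eq Some_inj) neq_other.
rewrite addKn => /(_ _ _ cm' cod_nil0 cm) le.
have {}le : (m <= tri n + m')%N.
  rewrite -[m']addn0; apply: le => [p w|w]; rewrite inE => /eqP [] //.
  by move=> -> _; constructor 2.
have := legG_le (a * e) b0; rewrite -/n => lg.
have {}le : (b * m <= b * tri n + b * m')%N by rewrite -mulnDr leq_mul2l le orbT.
rewrite -[emults _]/(e :: emults q) legS_cons mulnDr [(a * (n * e))%N]mulnCA.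
by lia.
Qed.

(** As for one valuation, with the sum of the two multiplicities at common points; once the chains
    part, the two induced ideals are treated separately by [single_lower]. *)
Lemma pair_lower a b p1 p2 w1 w2 m : (0 < b)%N ->
  cod (Jfam [:: (p1, w1); (p2, w2)]) m ->
  (a * (w1 + w2) <= b * m + legS a b (emults2 p1 p2))%N.
Proof.
move=> b0; elim: p1 p2 w1 w2 m => [|d1 q1 IH] [|d2 q2] w1 w2 m cm.
- have [||n [m1 [m2 [bF /cod_nil c1 /cod_nil c2 c]]]] :=
      @blowup_exact R [:: ([::], w1); ([::], w2)] None (Some 0) => //.
    by move=> p w'; rewrite !inE => /orP [] /eqP [-> _]; constructor 1.
  have wn1 : (w1 <= n)%N by apply: bF; rewrite !inE eqxx.
  have wn2 : (w2 <= n)%N by apply: bF; rewrite !inE eqxx orbT.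
  rewrite (cod_uniq cm c) // c1 c2 [emults2 _ _]/= legS_cons legS_nil !addn0.
  by apply: leq_trans (legG_ge _ n b0); nia.
- have [||n [m1 [m2 [bF c1 c2 c]]]] :=
      @blowup_exact R [:: ([::], w1); (d2 :: q2, w2)] d2 (other d2) => //.
    exact: neq_other.
    by move=> p w'; rewrite !inE => /orP [] /eqP [-> _]; [constructor 1|constructor 2].
  move: c1 c2; rewrite !child2 child1 !child1_neq //; last first.
    by rewrite /= (inj_eq Some_inj) neq_other.
  move=> /(single_lower a b0) c1 /cod_nil c2.
  have wn1 : (w1 <= n)%N by apply: bF; rewrite !inE eqxx.
  rewrite (cod_uniq cm c) // c2 addn0 [emults2 _ _]/= -/(emult (d2 :: q2)) legS_cons.
  set e := emult _ in c1 *; have := legG_ge (a * (1 + e)) n b0.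
  have : (a * (w1 + w2) <= n * (a * (1 + e)) + a * (w2 - n * e))%N by nia.
  by lia.
- have [||n [m1 [m2 [bF c1 c2 c]]]] :=
      @blowup_exact R [:: (d1 :: q1, w1); ([::], w2)] d1 (other d1) => //.
    exact: neq_other.
    by move=> p w'; rewrite !inE => /orP [] /eqP [-> _]; [constructor 2|constructor 1].
  move: c1 c2; rewrite !child2 child1 !child1_neq //; last first.
    by rewrite /= (inj_eq Some_inj) neq_other.
  move=> /(single_lower a b0) c1 /cod_nil c2.
  have wn1 : (w2 <= n)%N by apply: bF; rewrite !inE eqxx orbT.
  rewrite (cod_uniq cm c) // c2 addn0 [emults2 _ _]/= -/(emult (d1 :: q1)) legS_cons.
  set e := emult _ in c1 *; have := legG_ge (a * (e + 1)) n b0.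
  have : (a * (w1 + w2) <= n * (a * (e + 1)) + a * (w1 - n * e))%N by nia.
  by lia.
case: (eqVneq d1 d2) cm => [<-|nd] cm.
  have [||n [m1 [m2 [bF c1 c2 c]]]] :=
      @blowup_exact R [:: (d1 :: q1, w1); (d1 :: q2, w2)] d1 (other d1) => //.
    exact: neq_other.
    by move=> p w'; rewrite !inE => /orP [] /eqP [-> _]; constructor 2.
  move: c1 c2; rewrite !child2 !child1 !child1_neq //;
    try by rewrite /= (inj_eq Some_inj) neq_other.
  move=> /IH c1 /cod_nil c2.
  rewrite (cod_uniq cm c) // c2 addn0 [emults2 _ _]/= eqxx legS_cons.
  rewrite -/(emult (d1 :: q1)) -/(emult (d1 :: q2)).
  set e1 := emult (d1 :: q1) in c1 *; set e2 := emult (d1 :: q2) in c1 *.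
  have := legG_ge (a * (e1 + e2)) n b0.
  have : (a * (w1 + w2) <= n * (a * (e1 + e2)) +
    a * (w1 - n * e1 + (w2 - n * e2)))%N by nia.
  by lia.
have [||n [m1 [m2 [bF c1 c2 c]]]] :=
    @blowup_exact R [:: (d1 :: q1, w1); (d2 :: q2, w2)] d1 d2 => //.
  by move=> p w'; rewrite !inE => /orP [] /eqP [-> _]; [constructor 2|constructor 3].
move: c1 c2; rewrite !child2 !child1 !child1_neq ?cats0; first last.
- by rewrite /= (inj_eq Some_inj) eq_sym.
- by rewrite /= (inj_eq Some_inj).
move=> /(single_lower a b0) c1 /(single_lower a b0) c2.
rewrite (cod_uniq cm c) // [emults2 _ _]/= (negPf nd) legS_cons legS_cat.
rewrite -/(emult (d1 :: q1)) -/(emult (d2 :: q2)).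
set e1 := emult (d1 :: q1) in c1 *; set e2 := emult (d2 :: q2) in c2 *.
have := legG_ge (a * (e1 + e2)) n b0.
have : (a * (w1 + w2) <= n * (a * (e1 + e2)) +
  a * (w1 - n * e1) + a * (w2 - n * e2))%N by nia.
by lia.
Qed.

Lemma pair_upper a b p1 p2 : (0 < b)%N -> exists w1 w2 m,
  cod (Jfam [:: (p1, w1); (p2, w2)]) m /\
  (b * m + legS a b (emults2 p1 p2) <= a * (w1 + w2))%N.
Proof.
move=> b0; elim: p1 p2 => [|d1 q1 IH] [|d2 q2].
- pose n := ((a * (1 + 1)) %/ b)%N; exists n, n.
  have [m cm] := cod_Jfam [:: ([::] : ipt R, n); ([::], n)].
  exists m; split=> //.
  have le : (m <= tri n + (0 + 0))%N.
    apply: (@blowup_upper R [:: ([::], n); ([::], n)] None (Some 0) n m 0 0 _ _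
      cod_nil0 cod_nil0 cm) => [p w'|w']; rewrite !inE => /orP [] /eqP [];
      by [move=> -> _; constructor 1 | move=> ->].
  rewrite [emults2 _ _]/= legS_cons legS_nil.
  have := legG_le (a * (1 + 1)) b0; rewrite -/n.
  rewrite !addn0 in le *; have : (b * m <= b * tri n)%N by rewrite leq_mul2l le orbT.
  by nia.
- have [w' [m' [cm' IH2]]] := single_upper a q2 b0.
  set e := emult (d2 :: q2); pose n := ((a * (1 + e)) %/ b)%N.
  exists n, (n * e + w')%N.
  have [m cm] := cod_Jfam [:: ([::] : ipt R, n); (d2 :: q2, n * e + w')%N].
  exists m; split=> //.
  have le : (m <= tri n + (m' + 0))%N.
    apply: (@blowup_upper R _ d2 (other d2) n m m' 0 _ _ _ _ cm).
    + by move=> p w; rewrite !inE => /orP [] /eqP [-> _]; [constructor 1|constructor 2].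
    + by move=> w; rewrite !inE => /orP [] /eqP [] // ->.
    + by rewrite child2 child1 child1_neq // addKn.
    rewrite child2 !child1_neq //; first exact: cod_nil0.
    by rewrite /= (inj_eq Some_inj) neq_other.
  rewrite [emults2 _ _]/= -/(emult (d2 :: q2)) -/e legS_cons.
  have := legG_le (a * (1 + e)) b0; rewrite -/n.
  have : (b * m <= b * tri n + b * m')%N by rewrite -mulnDr leq_mul2l -[m']addn0 le orbT.
  by nia.
- have [w' [m' [cm' IH2]]] := single_upper a q1 b0.
  set e := emult (d1 :: q1); pose n := ((a * (e + 1)) %/ b)%N.
  exists (n * e + w')%N, n.
  have [m cm] := cod_Jfam [:: (d1 :: q1, n * e + w')%N; ([::] : ipt R, n)].
  exists m; split=> //.
  have le : (m <= tri n + (m' + 0))%N.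
    apply: (@blowup_upper R _ d1 (other d1) n m m' 0 _ _ _ _ cm).
    + by move=> p w; rewrite !inE => /orP [] /eqP [-> _]; [constructor 2|constructor 1].
    + by move=> w; rewrite !inE => /orP [] /eqP [] // ->.
    + by rewrite child2 child1 child1_neq // cats0 addKn.
    rewrite child2 !child1_neq //; first exact: cod_nil0.
    by rewrite /= (inj_eq Some_inj) neq_other.
  rewrite [emults2 _ _]/= -/(emult (d1 :: q1)) -/e legS_cons.
  have := legG_le (a * (e + 1)) b0; rewrite -/n.
  have : (b * m <= b * tri n + b * m')%N by rewrite -mulnDr leq_mul2l -[m']addn0 le orbT.
  by nia.
set e1 := emult (d1 :: q1); set e2 := emult (d2 :: q2).
pose n := ((a * (e1 + e2)) %/ b)%N.
have := legG_le (a * (e1 + e2)) b0; rewrite -/n => lg.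
case: (eqVneq d1 d2) => [dd|nd].
  have [w1 [w2 [m' [cm' IH2]]]] := IH q2.
  exists (n * e1 + w1)%N, (n * e2 + w2)%N.
  have [m cm] := cod_Jfam [:: (d1 :: q1, n * e1 + w1)%N; (d2 :: q2, n * e2 + w2)%N].
  exists m; split=> //.
  have le : (m <= tri n + (m' + 0))%N.
    apply: (@blowup_upper R _ d1 (other d1) n m m' 0 _ _ _ _ cm).
    + by move=> p w; rewrite !inE => /orP [] /eqP [-> _]; constructor 2; rewrite ?dd.
    + by move=> w; rewrite !inE => /orP [] /eqP [].
    + by rewrite child2 /e2 -dd !child1 !addKn.
    rewrite child2 -dd !child1_neq //; first exact: cod_nil0.
      by rewrite /= (inj_eq Some_inj) neq_other.
    by rewrite /= (inj_eq Some_inj) neq_other.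
  have -> : emults2 (d1 :: q1) (d2 :: q2) = (e1 + e2)%N :: emults2 q1 q2.
    by rewrite /e1 /e2 /= dd eqxx.
  rewrite legS_cons.
  have : (b * m <= b * tri n + b * m')%N by rewrite -mulnDr leq_mul2l -[m']addn0 le orbT.
  by nia.
have [w1 [m1 [cm1 IH1]]] := single_upper a q1 b0.
have [w2 [m2 [cm2 IH2]]] := single_upper a q2 b0.
exists (n * e1 + w1)%N, (n * e2 + w2)%N.
have [m cm] := cod_Jfam [:: (d1 :: q1, n * e1 + w1)%N; (d2 :: q2, n * e2 + w2)%N].
exists m; split=> //.
have le : (m <= tri n + (m1 + m2))%N.
  apply: (@blowup_upper R _ d1 d2 n m m1 m2 _ _ _ _ cm).
  + by move=> p w; rewrite !inE => /orP [] /eqP [-> _]; [constructor 2|constructor 3].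
  + by move=> w; rewrite !inE => /orP [] /eqP [].
  + rewrite child2 child1 child1_neq ?addKn //.
    by rewrite /= (inj_eq Some_inj) eq_sym.
  + by rewrite child2 child1 child1_neq ?addKn // /= (inj_eq Some_inj).
rewrite [emults2 _ _]/= (negPf nd) legS_cons legS_cat.
rewrite -/(emult (d1 :: q1)) -/(emult (d2 :: q2)) -/e1 -/e2.
have : (b * m <= b * tri n + (b * m1 + b * m2))%N by rewrite -!mulnDr leq_mul2l le orbT.
by nia.
Qed.

End Legendre.

(** * Multiplicity sequences and combinatorial equivalence *)

Section MultiplicitySequence.
Variable R : realType.
Implicit Types (p q : ipt R).

Lemma legG_eq0 b x : (x <= b)%N -> legG b x = 0%N.
Proof. by move=> xb; rewrite /legG big1 // => t _; nia. Qed.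

Lemma legG_gt0 b x : (b < x)%N -> (0 < legG b x)%N.
Proof.
by case: x => // x bx; rewrite /legG big_ord_recl /= muln1 addn_gt0 subn_gt0 bx.
Qed.

(** [legG b (2 x)] is positive exactly when [b < 2 x], so if the largest entries are [y < x], then
    [b = 2 y] tells the sums apart; equal heads are removed. The factor 2 makes entries equal to 1
    visible, since [legG b 1] is 0 for every [b > 0]. *)
Lemma legS_inj (s t : seq nat) : sorted geq s -> sorted geq t ->
  all (leq 1) s -> all (leq 1) t ->
  (forall b, (0 < b)%N -> legS 2 b s = legS 2 b t) -> s = t.
Proof.
have empty y (u : seq nat) : (0 < y)%N ->
    ~ (forall b, (0 < b)%N -> legS 2 b [::] = legS 2 b (y :: u)).
  move=> y0 /(_ 1%N isT); rewrite legS_nil legS_cons.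
  have : (0 < legG 1 (2 * y))%N by apply: legG_gt0; lia.
  by lia.
have head x y (u v : seq nat) : (0 < y)%N -> (y < x)%N -> path geq y v ->
    ~ (forall b, (0 < b)%N -> legS 2 b (x :: u) = legS 2 b (y :: v)).
  move=> y0 yx pv /(_ (2 * y)%N); rewrite muln_gt0 y0 => /(_ isT).
  have : (0 < legG (2 * y) (2 * x))%N by apply: legG_gt0; lia.
  have tv : transitive geq by move=> i j k /= ij jk; exact: leq_trans jk ij.
  have /allP le := order_path_min tv pv.
  have -> : legS 2 (2 * y) (y :: v) = 0%N.
    rewrite /legS big_seq big1 // => z; rewrite inE => /orP [/eqP ->|/le /= zy].
      exact: legG_eq0.
    by apply: legG_eq0; lia.
  by rewrite legS_cons; lia.
elim: s t => [|x s IH] [|y t] // ps pt /= => [_ /andP [y0 _]|/andP [x0 _] _|].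
- by move=> /empty; case.
- by move=> H; case: (@empty x s x0) => b b0; rewrite H.
move=> /andP [x0 ps0] /andP [y0 pt0] H.
case: (ltngtP x y) => [xy|yx|xy].
- by case: (@head y x t s) => // b b0; rewrite H.
- by case: (@head x y s t).
rewrite -xy in H *; congr (_ :: _); apply: IH => //.
- exact: path_sorted ps.
- exact: path_sorted pt.
by move=> b b0; have := H b b0; rewrite !legS_cons => /addnI.
Qed.

Lemma emults_cons d q : emults (d :: q) = emult (d :: q) :: emults q.
Proof. by []. Qed.

Lemma emults_sorted p : sorted geq (emults p).
Proof.
elim: p => [|d q IH] //; rewrite emults_cons.
by have := emult_cons d q; case: q IH => [|d' q] /= IH le; rewrite le.
Qed.

Lemma emults_gt0 p : all (leq 1) (emults p).
Proof.
elim: p => [|d q IH] //; rewrite emults_cons; apply/andP; split=> //.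
exact: emult_gt0.
Qed.

Lemma size_emults p : size (emults p) = (size p).+1.
Proof. by elim: p => [|d q IH] //=; rewrite IH. Qed.

Lemma nth_emults p k : (k <= size p)%N -> nth 0%N (emults p) k = emult (drop k p).
Proof. by elim: p k => [|d q IH] [|k] //= kq; exact: IH. Qed.

(** Chains sharing [lcp p q] directions share [lcp p q + 1] points, the origin included. *)
Fixpoint lcp p q : nat :=
  match p, q with
  | d :: p', d' :: q' => if d == d' then (lcp p' q').+1 else 0
  | _, _ => 0
  end.

Lemma lcp_size p q : (lcp p q <= size p)%N && (lcp p q <= size q)%N.
Proof. by elim: p q => [|d p IH] [|d' q] //=; case: ifP => // _; exact: IH. Qed.

Lemma take_lcp p q k : (k <= size p)%N -> (k <= size q)%N ->
  (take k p == take k q) = (k <= lcp p q)%N.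
Proof.
elim: p q k => [|d p IH] [|d' q] [|k] //= kp kq.
by rewrite eqseq_cons; case: eqP => //= _; exact: IH.
Qed.

(* The intersection number of generic curvettes of [p] and [q]. *)
Definition cross p q :=
  (\sum_(j < (lcp p q).+1) nth 0 (emults p) j * nth 0 (emults q) j)%N.

(** [legG 1 n] is [n (n - 1) / 2], whose polarisation is the product. *)
Lemma legG1D x y : legG 1 (x + y) = (legG 1 x + legG 1 y + x * y)%N.
Proof.
have G1 n : legG 1 n = 'C(n, 2).
  rewrite /legG -bin2_sum big_mkord (reindex_inj rev_ord_inj) /=.
  by apply: eq_bigr => i _; have := ltn_ord i; lia.
rewrite !G1; elim: y => [|y IH]; first by rewrite addn0 muln0 bin0n !addn0.
by rewrite addnS !binS !bin1 IH; nia.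
Qed.

(** Only common points contribute a cross term, so the transform of a pair exceeds those of its
    members by the intersection number. *)
Lemma legS_emults2 p q : legS 1 1 (emults2 p q) =
  (legS 1 1 (emults p) + legS 1 1 (emults q) + cross p q)%N.
Proof.
elim: p q => [|d p IH] [|d' q]; rewrite /cross.
- by rewrite big_ord1 /= !legS_cons !legS_nil !mul1n legG1D; lia.
- rewrite big_ord1 emults_cons -[emults2 _ _]/((1 + emult (d' :: q))%N :: emults q).
  set e := emult (d' :: q); rewrite /= !legS_cons legS_nil !mul1n legG1D; lia.
- rewrite big_ord1 emults_cons -[emults2 _ _]/((emult (d :: p) + 1)%N :: emults p).
  set e := emult (d :: p); rewrite /= !legS_cons legS_nil !mul1n legG1D; lia.
have -> : emults2 (d :: p) (d' :: q) = (emult (d :: p) + emult (d' :: q))%N ::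
    (if d == d' then emults2 p q else emults p ++ emults q) by [].
rewrite !emults_cons !legS_cons !mul1n legG1D big_ord_recl.
set e := emult (d :: p); set e' := emult (d' :: q); rewrite /=.
case: ifP => _; last by rewrite big_ord0 legS_cat; lia.
by rewrite IH -[X in _ = (_ + (_ + X))%N]/(cross p q); lia.
Qed.

(** For given multiplicities [cross] is a sum of [lcp + 1] positive terms, hence strictly increasing
    in [lcp]. *)
Lemma cross_lcp p q p' q' : emults p = emults p' -> emults q = emults q' ->
  cross p q = cross p' q' -> lcp p q = lcp p' q'.
Proof.
pose E p q j := (nth 0 (emults p) j * nth 0 (emults q) j)%N.
have sumE u v : cross u v = (\sum_(0 <= j < (lcp u v).+1) E u v j)%N.
  by rewrite big_mkord.
have posE u v j : (j <= lcp u v)%N -> (0 < E u v j)%N.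
  move=> jl; have /andP [l1 l2] := lcp_size u v.
  rewrite muln_gt0 !nth_emults ?emult_gt0 //; exact: leq_trans jl _.
have key u v u' v' : E u v = E u' v' -> (lcp u v < lcp u' v')%N ->
    (cross u v < cross u' v')%N.
  move=> EE lt; rewrite !sumE (@big_cat_nat _ _ _ (lcp u v).+1 0 (lcp u' v').+1) //=.
    rewrite EE -[ltnLHS]addn0 ltn_add2l big_ltn ?ltnS // addn_gt0.
    by rewrite posE.
  by rewrite ltnS ltnW.
move=> e1 e2 ec; have EE : E p q = E p' q' by rewrite /E e1 e2.
case: (ltngtP (lcp p q) (lcp p' q')) => // lt.
- by have := key _ _ _ _ EE lt; rewrite ec ltnn.
- by have := key _ _ _ _ (esym EE) lt; rewrite ec ltnn.
Qed.

(** * Order and proximity read off from the multiplicities *)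

Lemma labels_rcons q d : labels (rcons q d) = lab_step (labels q) d.
Proof. by rewrite /labels foldl_rcons. Qed.

(* The value of a component through the point is what remains of its
   multiplicity after subtracting those of the points proximate to it so far. *)
Lemma labels_take p k : (k <= size p)%N ->
  let E := nth 0%N (emults p) in
  let: (s, A, B) := labels (take k p) in
  [/\ s = take k p,
      forall t, A = Some t -> exists2 j, (j < k)%N & t = take j p /\
        ((vXY (drop k p)).1 + \sum_(j.+1 <= i < k) E i = E j)%N,
      forall t, B = Some t -> exists2 j, (j < k)%N & t = take j p /\
        ((vXY (drop k p)).2 + \sum_(j.+1 <= i < k) E i = E j)%N
    & forall j, (j < k)%N -> A <> Some (take j p) -> B <> Some (take j p) ->
        (E j <= \sum_(j.+1 <= i < k) E i)%N].
Proof.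
move=> + E; elim: k => [|k IH] kp; first by rewrite take0.
have {IH} := IH (ltnW kp).
have [d0 _] : {d0 : dir R | True} by exists None.
rewrite (take_nth d0 kp) labels_rcons.
case: (labels (take k p)) => [[s A] B] [-> HA HB HN].
have Ek : E k = emult (drop k p) by rewrite /E nth_emults // ltnW.
rewrite (drop_nth d0 kp) in HA HB Ek.
have sumS j : (j < k)%N ->
    (\sum_(j.+1 <= i < k.+1) E i = \sum_(j.+1 <= i < k) E i + E k)%N.
  by move=> jk; rewrite big_nat_recr.
case: (nth d0 p k) HA HB Ek => [c|] /=; case: (vXY (drop k.+1 p)) => x y /= HA HB Ek.
- split=> //.
  + move=> t [<-]; exists k => //; split=> //.
    by rewrite big_geq // addn0 Ek.
  + case: eqP HB => // _ HB t /HB [j jk [-> e]]; exists j; first exact: ltnW.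
    by split=> //; rewrite sumS // -e Ek; lia.
  + move=> j; rewrite ltnS leq_eqVlt => /orP [/eqP ->|jk] NA NB; first by case: NA.
    rewrite sumS // Ek.
    case: (pselect (A = Some (take j p))) => [/HA [j' jk' [tt e]]|nA].
      have ej : j = j'.
        have := congr1 size tt; rewrite !size_take; case: ifP; case: ifP; lia.
      by rewrite ej -e; lia.
    case: (pselect (B = Some (take j p))) => [eB|nB]; last first.
      by have := HN j jk nA nB; lia.
    have [j' jk' [tt]] := HB _ eB.
    have ej : j = j'.
      have := congr1 size tt; rewrite !size_take; case: ifP; case: ifP; lia.
    by rewrite -ej; case: eqP NB => [_ /(_ eB)|_ _] //; lia.
- split=> //.
  + move=> t /HA [j jk [-> e]]; exists j; first exact: ltnW.
    by split=> //; rewrite sumS // -e Ek; lia.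
  + move=> t [<-]; exists k => //; split=> //.
    by rewrite big_geq // addn0 Ek.
  + move=> j; rewrite ltnS leq_eqVlt => /orP [/eqP ->|jk] NA NB; first by case: NB.
    rewrite sumS // Ek.
    case: (pselect (B = Some (take j p))) => [/HB [j' jk' [tt e]]|nB].
      have ej : j = j'.
        have := congr1 size tt; rewrite !size_take; case: ifP; case: ifP; lia.
      by rewrite ej -e; lia.
    by have := HN j jk NA nB; lia.
Qed.

(** A component through the point has positive value there, so the multiplicities in between do not
    exhaust that of [take j p]; by [labels_take] they do once the component no longer passes through
    the point. *)
Lemma proximate_take p k j : (k <= size p)%N -> (j <= size p)%N ->
  proximate (take k p) (take j p) = (j < k)%N &&
    (\sum_(j.+1 <= i < k) nth 0%N (emults p) i < nth 0%N (emults p) j)%N.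
Proof.
move=> kp jp; have := labels_take kp; rewrite /proximate.
case: (labels (take k p)) => [[s A] B] [_ HA HB HN].
have /andP [x0 y0] := vXY_gt0 (drop k p).
have inj j' : (j' < k)%N -> take j p = take j' p -> j = j'.
  by move=> jk /(congr1 size); rewrite !size_take; case: ifP; case: ifP; lia.
case: eqP => [/HA [j' jk [tt e]]|nA] /=.
  by rewrite (inj _ jk tt) jk -e; lia.
case: eqP => [/HB [j' jk [tt e]]|nB] /=.
  by rewrite (inj _ jk tt) jk -e; lia.
case: (ltnP j k) => //= jk; have := HN j jk nA nB; lia.
Qed.

Lemma proximate_prefix q p : proximate q p ->
  exists2 j, (j < size q)%N & p = take j q.
Proof.
have := labels_take (leqnn (size q)); rewrite take_size /proximate.
case: (labels q) => [[s A] B] [_ HA HB _] /orP [] /eqP.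
  by move=> /HA [j jk [-> _]]; exists j.
by move=> /HB [j jk [-> _]]; exists j.
Qed.

(** With points addressed by chain and position, the order depends only on positions and [lcp], and
    proximity, treated next, only on these and the multiplicities. *)
Lemma pprefix_take p q k l : (k <= size p)%N -> (l <= size q)%N ->
  pprefix (take k p) (take l q) = (k < l)%N && (k <= lcp p q)%N.
Proof.
move=> kp lq; rewrite /pprefix prefixE.
have st (u : ipt R) i : (i <= size u)%N -> size (take i u) = i.
  by move=> iu; rewrite size_takel.
rewrite st //; case: (ltngtP k l) => [kl|lk|kl].
- have kl' := ltnW kl; have kq := leq_trans kl' lq.
  rewrite take_takel // eq_sym take_lcp //.
  rewrite andb_idr // => _; apply/eqP => /(congr1 size).
  by rewrite !st // => e; rewrite e ltnn in kl.
- rewrite take_oversize; last by rewrite st // ltnW.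
  by rewrite [take l q == _]eq_sym; case: eqP.
rewrite take_oversize; last by rewrite st // kl.
by rewrite [take l q == _]eq_sym; case: eqP.
Qed.

Lemma proximate_take2 p q k l : (k <= size p)%N -> (l <= size q)%N ->
  proximate (take l q) (take k p) = [&& (k < l)%N, (k <= lcp p q)%N &
    (\sum_(k.+1 <= i < l) nth 0%N (emults q) i < nth 0%N (emults q) k)%N].
Proof.
move=> kp lq; apply/idP/idP => [prox|/and3P [kl kpq lt]].
  have [j] := proximate_prefix prox; rewrite size_takel // => jl tt.
  have kj : k = j.
    have := congr1 size tt; rewrite !size_take.
    by case: ifP; case: ifP; case: ifP; lia.
  rewrite -kj take_takel in tt; last by lia.
  have kpq : (k <= lcp p q)%N by rewrite -take_lcp // ?tt //; lia.
  by move: prox; rewrite tt proximate_take ?kpq //; lia.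
have -> : take k p = take k q by apply/eqP; rewrite take_lcp //; lia.
by rewrite proximate_take ?kl //; lia.
Qed.

Lemma comb_equiv_of_emults r (P P' : 'I_r -> ipt R) :
  (forall i, emults (P i) = emults (P' i)) ->
  (forall i j, lcp (P i) (P j) = lcp (P' i) (P' j)) -> comb_equiv P P'.
Proof.
move=> eE eL; rewrite /comb_equiv.
have eS i : size (P i) = size (P' i).
  by have := congr1 size (eE i); rewrite !size_emults => -[].
(* Any chain through [s] may be picked: chains agreeing up to a position have counterparts agreeing
   up to it, because the values of [lcp] coincide. *)
pose phi s := if [pick i | prefix s (P i)] is Some i then take (size s) (P' i) else s.
have phi_take i k : (k <= size (P i))%N -> phi (take k (P i)) = take k (P' i).
  move=> ki; rewrite /phi; case: pickP => [i'|/(_ i)]; last by rewrite prefix_take.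
  rewrite prefixE size_takel // => /eqP tt.
  have ki' : (k <= size (P i'))%N.
    have := congr1 size tt; rewrite [RHS]size_takel // => e.
    by rewrite -{1}e size_take_min geq_minr.
  by apply/eqP; rewrite take_lcp -?eS // -eL -take_lcp // tt.
have VP (Q : 'I_r -> ipt R) s : minres Q s ->
    exists i k, (k <= size (Q i))%N /\ s = take k (Q i).
  move=> [i ps]; exists i, (size s); split; first exact: size_prefix.
  by move: ps; rewrite prefixE => /eqP.
have VT (Q : 'I_r -> ipt R) i k : minres Q (take k (Q i)).
  by exists i; exact: prefix_take.
have phiS s' : minres P' s' -> exists s, minres P s /\ phi s = s'.
  move=> /VP [i [k [ki ->]]]; exists (take k (P i)); split=> //.
  by rewrite phi_take // eS.
have phiV s : minres P s -> minres P' (phi s).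
  by move=> /VP [i [k [ki ->]]]; rewrite phi_take.
have pp s t : minres P s -> minres P t -> pprefix s t = pprefix (phi s) (phi t).
  move=> /VP [i [k [ki ->]]] /VP [j [l [lj ->]]].
  by rewrite !phi_take // !pprefix_take -?eS // eL.
have px s t : minres P s -> minres P t -> proximate s t = proximate (phi s) (phi t).
  move=> /VP [i [k [ki ->]]] /VP [j [l [lj ->]]].
  by rewrite !phi_take // !proximate_take2 -?eS // eL eE.
have mu s t : minres P s -> minres P t ->
    meets_up (minres P) s t <-> meets_up (minres P') (phi s) (phi t).
  move=> Vs Vt; rewrite /meets_up px //.
  split=> -[prox no]; split=> // -[q' [Vq [pq xq]]]; apply: no.
    have [q [Vq' eq]] := phiS _ Vq; exists q; split=> //.
    by rewrite pp // px // eq.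
  by exists (phi q'); split; [exact: phiV | rewrite -pp // -px].
exists phi; split=> //; split.
  move=> s t /VP [i [k [ki ->]]] /VP [j [l [lj ->]]]; rewrite !phi_take // => tt.
  have kl : k = l by have := congr1 size tt; rewrite !size_takel -?eS.
  rewrite -kl in lj tt *; apply/eqP; rewrite take_lcp // eL -take_lcp -?eS //.
  by rewrite tt.
split=> //; split.
  move=> s t Vs Vt; rewrite /dual_edge !mu //.
  by split=> -[_ [_ H]]; do ?split=> //; exact: phiV.
split=> [s t Vs Vt|i]; first by rewrite pp.
by rewrite -{1}[P i]take_size phi_take // eS take_size.
Qed.

End MultiplicitySequence.

(** * The Poincare series as a mixed difference of codimensions *)

Section DivisorialValues.
Variable R : realType.
Implicit Types (f g : series R) (p : ipt R).

(** Values are nonnegative, so a negative bound imposes the same condition as 0. *)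
Definition natpart (k : int) : nat := if k is Posz n then n else 0.

(** A monomial of degree [a] at [p] acquires the factor [u^a] in the chart; this identifies the
    multiplicity along [E_p] with the order at [p]. *)
Lemma chartE_coef p f a b :
  chartE p f a b = if (b <= a)%N then pull p f (a - b)%N b else 0.
Proof. by rewrite /chartE stepT_some addr0 comp_polyXr hformE. Qed.

Lemma is_uordP g : is_uord g (uord g).
Proof.
apply: epsilon_spec; case: (pselect (exists n, exists b, g n b != 0)); last first.
  move=> H; exists None => a b; apply/eqP/negPn/negP => gab.
  by apply: H; exists a, b.
move=> H; pose Q n := `[< exists b, g n b != 0 >].
have exQ : exists n, Q n by case: H => n Hn; exists n; apply/asboolP.
case: (ex_minnP exQ) => n /asboolP Hn minn; exists (Some n); split=> // a b an.
apply/eqP/negPn/negP => gab; have : Q a by apply/asboolP; exists b.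
by move=> /minn; rewrite leqNgt an.
Qed.

Lemma vge_uord g k : vge (uord g) k <->
  forall a b, (a < natpart k)%N -> g a b = 0.
Proof.
have := is_uordP g; case: (uord g) => [n|] /=; last by move=> H; split.
move=> [[b gn] H]; split=> [kn a b' ak|H'].
  by apply: H; case: k kn ak => //= k kn ak; lia.
case: k H' => [k|k] //= H'; rewrite lez_nat leqNgt; apply/negP => nk.
by move: gn; rewrite H' ?eqxx.
Qed.

Lemma vge_divval p f k : vge (divval p f) k <-> ordge (natpart k) (pull p f).
Proof.
rewrite /divval vge_uord; split=> H a b ab.
  by have := H (a + b)%N b ab; rewrite chartE_coef leq_addl addnK.
rewrite chartE_coef; case: leqP => // ba; apply: H; lia.
Qed.

Definition famof r (P : 'I_r -> ipt R) (w : 'I_r -> int) : seq (ipt R * nat) :=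
  [seq (P i, natpart (w i)) | i <- enum 'I_r].

Lemma famofP r (P : 'I_r -> ipt R) w f :
  Jfam (famof P w) f <-> forall i, ordge (natpart (w i)) (pull (P i) f).
Proof.
split=> [H i|H _ /mapP [i _ ->]]; last exact: H.
by apply: (H (P i, natpart (w i))); apply/mapP; exists i; rewrite ?mem_enum.
Qed.

Lemma JsetE r (P : 'I_r -> ipt R) w f :
  Jset P w f <-> convergent f /\ Jfam (famof P w) f.
Proof.
split=> -[cf H]; split=> //; first by apply/famofP => i; apply/vge_divval.
by move=> i; apply/vge_divval; move/famofP: H.
Qed.

Definition trunc N f : series R := fun a b => if (a + b < N)%N then f a b else 0.

Local Notation normc := ComplexField.Normc.normc.

Lemma normc_ge0 (x : R[i]) : 0 <= normc x.
Proof. by case: x => a b; exact: sqrtr_ge0. Qed.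

Lemma normc_zero : normc (0 : R[i]) = 0.
Proof. by rewrite /= expr0n addr0 sqrtr0. Qed.

Lemma convergent_trunc N f : convergent (trunc N f).
Proof.
exists 1, (\sum_(i < N) \sum_(j < N) normc (f i j)); split=> // i j.
rewrite expr1n mulr1 /trunc.
have S0 i' : 0 <= \sum_(j < N) normc (f i' j).
  by apply: sumr_ge0 => *; exact: normc_ge0.
case: ifP => ij; last by rewrite normc_zero; apply: sumr_ge0.
have iN : (i < N)%N by lia.
have jN : (j < N)%N by lia.
rewrite (bigD1 (Ordinal iN)) //= (bigD1 (Ordinal jN)) //= -addrA lerDl.
by apply: addr_ge0; apply: sumr_ge0 => *; rewrite ?normc_ge0.
Qed.

Lemma convergentP c f g : convergent f -> convergent g -> convergent (c *: f + g).
Proof.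
move=> [r1 [M1 [r10 H1]]] [r2 [M2 [r20 H2]]].
exists (Num.min r1 r2), (normc c * M1 + M2); split; first by rewrite lt_min r10 r20.
move=> i j; have m0 : 0 <= Num.min r1 r2 by rewrite le_min !ltW.
rewrite seriesDE seriesZE.
apply: (le_trans (y := (normc (c * f i j) + normc (g i j)) * Num.min r1 r2 ^+ (i + j))).
  by apply: ler_wpM2r; [exact: exprn_ge0 | exact: le_normcD].
rewrite mulrDl ComplexField.Normc.normcM -mulrA; apply: lerD.
  apply: ler_wpM2l; first exact: normc_ge0.
  apply: le_trans (H1 i j); apply: ler_wpM2l; first exact: normc_ge0.
  by apply: lerXn2r; rewrite ?nnegrE ?(ltW r10) // ge_min lexx.
apply: le_trans (H2 i j); apply: ler_wpM2l; first exact: normc_ge0.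
by apply: lerXn2r; rewrite ?nnegrE ?(ltW r20) // ge_min lexx orbT.
Qed.

Lemma convergent_linset : linset (@convergent R).
Proof.
split; last exact: convergentP.
exists 1, 0; split=> // i j; rewrite series0E normc_zero mul0r //.
Qed.

Lemma lincombE d (c : 'I_d -> R[i]) (fs : 'I_d -> series R) :
  lincomb c fs = \sum_k c k *: fs k.
Proof. by apply: seriesP => a b; rewrite /lincomb !fct_sumE. Qed.

(** The quotient of [J] by [J'] is the kernel of the induced surjection [M], of dimension [m' - m].
    Truncating at order [N] changes a series by an element of [J'], so convergent series represent
    every class. *)
Lemma quotdim_of_cod (J J' : series R -> Prop) N m m' :
  linset J -> linset J' -> cod J m -> cod J' m' -> (forall f, J' f -> J f) ->
  (forall f, ordge N f -> J' f) ->
  IsQuotDim (fun f => convergent f /\ J f) (fun f => convergent f /\ J' f) (m' - m).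
Proof.
move=> LJ LJ' cJ cJ' JJ HN; have [phi [M [kphi sphi kM rM]]] := cod_factor cJ cJ' JJ.
have [F HF] := cod_lift sphi.
have rk : \rank (kermx M) = (m' - m)%N by rewrite mxrank_ker rM.
rewrite -rk; set d := \rank _; split.
  pose B := row_base (kermx M).
  pose g k := \sum_i (row k B) 0 i *: F i.
  have phi_g k : phi (trunc N (g k)) = row k B.
    rewrite -[RHS](HF (row k B)) -/(g k); apply/eqP; rewrite -subr_eq0 -(linearB phi).
    apply/eqP/kphi/HN => a b ab.
    by rewrite seriesBE /trunc ab subrr.
  exists (fun k => trunc N (g k)); split=> [k|c [_ /kphi]].
    split; first exact: convergent_trunc.
    apply/kM; rewrite phi_g; apply/sub_kermxP.
    by apply: submx_trans (row_sub _ _) _; rewrite eq_row_base.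
  rewrite lincombE linear_row => H k.
  have H' : (\row_k c k) *m B = 0.
    rewrite mulmx_sum_row -[RHS]H; apply: eq_bigr => i _; by rewrite mxE phi_g.
  have /row_freeP [D BD] : row_free B := row_base_free (kermx M).
  have : (\row_k c k) = 0 by rewrite -[LHS]mulmx1 -BD mulmxA H' mul0mx.
  by move=> /rowP /(_ k); rewrite !mxE.
move=> fs Jfs; pose W := \matrix_(k < d.+1) phi (fs k).
have WK : (W <= kermx M)%MS.
  by apply/row_subP => k; rewrite rowK; apply/sub_kermxP/kM; case: (Jfs k).
have : kermx W != 0.
  rewrite kermx_eq0 /row_free; apply/eqP => rW.
  by have := mxrankS WK; rewrite rW -/d ltnn.
move=> /rowV0Pn [v /sub_kermxP vW v0].
exists (fun k => v 0 k); split.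
  apply: contrapT => H; move/eqP: v0; apply; apply/rowP => k; rewrite mxE.
  by apply/eqP/negPn/negP => vk; apply: H; exists k.
rewrite lincombE; split.
  by apply: (linset_sum _ _ convergent_linset) => k; case: (Jfs k).
apply/kphi; rewrite linear_row -[RHS]vW mulmx_sum_row.
by apply: eq_bigr => k _; rewrite rowK.
Qed.

Lemma quotdim_le (A B : series R -> Prop) d d' :
  IsQuotDim A B d -> IsQuotDim A B d' -> (d <= d')%N.
Proof.
move=> [[fs [Afs ind]] _] [_ dep]; rewrite leqNgt; apply/negP => dd.
have [c [[k ck] Bc]] := dep (fun k => fs (widen_ord dd k)) (fun k => Afs _).
pose c' (i : 'I_d) := if insub (i : nat) is Some j then c j else 0.
have cc k' : c' (widen_ord dd k') = c k' by rewrite /c' /= valK.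
have : B (lincomb c' fs).
  suff -> : lincomb c' fs = lincomb c (fun k => fs (widen_ord dd k)) by [].
  apply: seriesP => a b; rewrite /lincomb.
  rewrite [RHS](eq_bigr (fun k' : 'I_d'.+1 =>
      c' (widen_ord dd k') * fs (widen_ord dd k') a b)).
    rewrite (bigID (fun i : 'I_d => (i < d'.+1)%N)) /= [X in _ + X]big1 ?addr0.
      by rewrite (big_ord_narrow dd).
    by move=> i id; rewrite /c' insubN // mul0r.
  by move=> k' _; rewrite cc.
by move=> /ind /(_ (widen_ord dd k)) /eqP; rewrite cc (negPf ck).
Qed.

Lemma qdimE (A B : series R -> Prop) d : IsQuotDim A B d -> qdim A B = d.
Proof.
move=> H; have H' : IsQuotDim A B (qdim A B) by apply: epsilon_spec; exists d.
by apply/eqP; rewrite eqn_leq !(quotdim_le H H', quotdim_le H' H).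
Qed.

Definition hcod r (P : 'I_r -> ipt R) w : nat := projT1 (cid (cod_Jfam (famof P w))).

Lemma hcodP r (P : 'I_r -> ipt R) w : cod (Jfam (famof P w)) (hcod P w).
Proof. by rewrite /hcod; case: cid. Qed.

Lemma hcod_ext r (P : 'I_r -> ipt R) w w' :
  (forall i, natpart (w i) = natpart (w' i)) -> hcod P w = hcod P w'.
Proof.
move=> H; have e : famof P w = famof P w' by apply: eq_map => i; rewrite H.
by rewrite /hcod e.
Qed.

Lemma Lcoef_hcod r (P : 'I_r -> ipt R) w :
  Lcoef P w = (hcod P (fun i => w i + 1))%:Z - (hcod P w)%:Z.
Proof.
set w' := fun i => w i + 1.
have JJ f : Jfam (famof P w') f -> Jfam (famof P w) f.
  move=> /famofP H; apply/famofP => i; apply: ordgeW (H i).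
  by rewrite /w'; case: (w i) => n //=; lia.
have le := cod_mono (hcodP P w) (hcodP P w') JJ.
rewrite /Lcoef subzn //; congr Posz; apply: qdimE.
have E u : Jset P u = (fun f => convergent f /\ Jfam (famof P u) f).
  by apply: funext => f; apply/propext; exact: JsetE.
rewrite !E; apply: quotdim_of_cod JJ (@Jfam_ordge R (famof P w')).
- exact: Jfam_linset.
- exact: Jfam_linset.
- exact: hcodP.
- exact: hcodP.
Qed.

End DivisorialValues.

(** * Mixed differences of functions on the integer lattice *)

Section MixedDifference.
Variable r : nat.
Implicit Types (F : ('I_r -> int) -> int) (u : 'I_r -> int) (S T : {set 'I_r}).

Definition shift u T : 'I_r -> int := fun i => u i + ((i \in T) : nat)%:Z.

(** The product over [i] in [S] of the operators identity minus unit shift in [i], applied to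
    [F]. *)
Definition mixdiff S F u : int :=
  \sum_(T : {set 'I_r} | T \subset S) (-1) ^+ #|T| * F (shift u T).

Lemma shift0 u : shift u set0 = u.
Proof. by apply: funext => i; rewrite /shift inE addr0. Qed.

Lemma shift_setU1 u i T : i \notin T -> shift u (i |: T) = shift (shift u [set i]) T.
Proof.
move=> iT; apply: funext => k; rewrite /shift !inE -addrA; congr (_ + _).
by case: eqP => [->|_] /=; rewrite ?(negPf iT) ?addr0 ?add0r.
Qed.

Lemma mixdiff_setU1 S F u i : i \notin S ->
  mixdiff (i |: S) F u = mixdiff S F u - mixdiff S F (shift u [set i]).
Proof.
move=> iS; rewrite /mixdiff (bigID (fun T => i \in T)) /= addrC; congr (_ + _).
  apply: eq_bigl => T; apply/andP/idP => [[TS iT]|TS].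
    apply/subsetP => k kT; have := subsetP TS k kT; rewrite !inE => /orP [/eqP ki|//].
    by rewrite -ki kT in iT.
  split; first exact: subset_trans TS (subsetU1 _ _).
  by apply: contra iS => /(subsetP TS).
rewrite (reindex_onto (fun T => i |: T) (fun T => T :\ i)) /=; last first.
  by move=> T /andP [_ iT]; rewrite setD1K.
rewrite -sumrN; apply: eq_big => [T|T /andP [_ /eqP iT]].
  apply/andP/idP => [[/andP [TS _] /eqP iT]|TS].
    have nT : i \notin T by rewrite -iT !inE eqxx.
    apply/subsetP => k kT; have := subsetP TS k; rewrite !inE kT orbT => /(_ isT).
    by case/orP => // /eqP ki; rewrite -ki kT in nT.
  have nT : i \notin T by apply: contra iS => /(subsetP TS).
  by rewrite setU1K // eqxx setU11 setUS.
have nT : i \notin T by rewrite -iT !inE eqxx.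
by rewrite shift_setU1 // cardsU1 nT exprS mulN1r mulNr.
Qed.

Lemma mixdiff_eq S F u i : i \in S ->
  (forall T, T \subset S :\ i -> F (shift u T) = F (shift (shift u [set i]) T)) ->
  mixdiff S F u = 0.
Proof.
move=> iS H; rewrite -(setD1K iS) mixdiff_setU1 ?inE ?eqxx //.
by apply/eqP; rewrite subr_eq0; apply/eqP/eq_bigr => T TS; rewrite H.
Qed.

(** Downward induction on [S]: if the difference in [j |: S] vanishes, the one in [S] is unchanged
    by moving along [j], and far out it is 0 because a step in some [i] of [S] no longer changes
    [D]. For singletons this makes [D] constant. *)
Lemma mixdiff_inj (D : ('I_r -> int) -> int) : (0 < r)%N ->
  (forall u, mixdiff setT D u = 0) ->
  (forall i j, i != j -> forall K : nat, exists W : nat, forall u,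
     W%:Z <= u j -> u i < K%:Z -> D (shift u [set i]) = D u) ->
  D (fun=> 0) = 0 -> forall w : 'I_r -> nat, D (fun i => (w i)%:Z) = 0.
Proof.
move=> r0 DT Dfar D0.
have zero n : forall S, #|~: S| = n -> S != set0 -> forall u, mixdiff S D u = 0.
  elim: n => [|n IH] S cS S0 u.
    have -> : S = setT by apply: setC_inj; apply/eqP; rewrite setCT -cards_eq0 cS.
    exact: DT.
  have /set0Pn [j] : ~: S != set0 by rewrite -cards_eq0 cS.
  rewrite inE => jS.
  have stepj v : mixdiff S D v = mixdiff S D (shift v [set j]).
    apply/eqP; rewrite -subr_eq0 -mixdiff_setU1 //; apply/eqP/IH.
      have : #|~: S| = (#|~: (j |: S)|).+1.
        by rewrite (cardsD1 j (~: S)) inE jS setDE -setCU setUC.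
      by rewrite cS => -[].
    by apply/set0Pn; exists j; rewrite setU11.
  have stepsj t : mixdiff S D u =
      mixdiff S D (fun k => u k + (if k == j then t%:Z else 0)).
    elim: t => [|t ->]; first by congr mixdiff; apply: funext => k; rewrite if_same addr0.
    rewrite stepj; congr mixdiff; apply: funext => k; rewrite /shift inE -addrA.
    by case: (k == j) => //=; rewrite -PoszD addn1.
  have /set0Pn [i iS] := S0.
  have ij : i != j by apply: contra jS => /eqP <-.
  have [W HW] := Dfar i j ij (natpart (u i)).+1.
  (* Adding [|u j|] makes up for a negative [u j], so that [u j + t >= W]. *)
  pose t := (W + `|u j|)%N.
  rewrite (stepsj t); apply: (mixdiff_eq iS) => T TS.
  have iT : i \notin T by apply/negP => /(subsetP TS); rewrite !inE eqxx.
  have sC v : shift (shift v [set i]) T = shift (shift v T) [set i].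
    by apply: funext => k; rewrite /shift addrAC.
  rewrite sC HW //.
    rewrite /shift eqxx; apply: (@le_trans _ _ (u j + t%:Z)); last by rewrite lerDl.
    by rewrite /t; lia.
  rewrite /shift (negPf iT) (negPf ij) !addr0; case: (u i) => k /=; lia.
have stepD u i : D (shift u [set i]) = D u.
  have i0 : [set i] != set0 by apply/set0Pn; exists i; rewrite inE.
  have := zero _ [set i] erefl i0 u; rewrite -[[set i]]setU0 mixdiff_setU1 ?inE // setU0.
  rewrite /mixdiff !(big_pred1 set0) => [|T|T]; try by rewrite subset0.
  by rewrite cards0 !mul1r !shift0 => /eqP; rewrite subr_eq0 => /eqP.
move=> w; have [n] := ubnP (\sum_i w i); elim: n w => // n IH w wn.
case: (pselect (exists i, (0 < w i)%N)) => [[i wi]|H]; last first.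
  rewrite -[RHS]D0; congr D; apply: funext => i; congr Posz.
  by apply/eqP; rewrite -leqn0 leqNgt; apply/negP => wi; apply: H; exists i.
pose w' k := (w k - (k == i))%N.
have -> : (fun k => (w k)%:Z) = shift (fun k => (w' k)%:Z) [set i].
  apply: funext => k; rewrite /shift inE /w' -PoszD; congr Posz.
  by case: eqP => [->|_] /=; lia.
rewrite stepD; apply: IH; rewrite (bigD1 i) //=; rewrite (bigD1 i) //= in wn.
have le : (\sum_(k | k != i) w' k <= \sum_(k | k != i) w k)%N.
  by apply: leq_sum => k _; exact: leq_subr.
have -> : w' i = (w i).-1 by rewrite /w' eqxx subn1.
apply: leq_ltn_trans (leq_add (leqnn _) le) _.
by rewrite -ltnS; apply: leq_ltn_trans wn; rewrite -addSn prednK.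
Qed.

End MixedDifference.

(** * The Poincare series determines the codimension function *)

Section PoincareDetermines.
Variables (R : realType) (r : nat).
Implicit Types (P : 'I_r -> ipt R) (u : 'I_r -> int).

Definition hint P u : int := (hcod P u)%:Z.

(** With [T] the complement of [S], the exponent [w - 1_S] equals [w - 1 + 1_T], and [Lcoef] is the
    codimension at [w + 1_T] minus the one there. *)
Lemma Pprime_mixdiff P (w : 'I_r -> nat) : Pprime P w =
  mixdiff setT (hint P) (fun i => (w i)%:Z) -
  mixdiff setT (hint P) (fun i => (w i)%:Z - 1).
Proof.
rewrite /Pprime (reindex_inj (@setC_inj _)) /mixdiff -sumrB; apply: eq_big => [T|T _].
  by rewrite subsetT.
have -> : (r - #|~: T| = #|T|)%N by have := cardsC T; rewrite card_ord; lia.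
rewrite Lcoef_hcod mulrBr; congr (_ * _ - _ * _); congr (hint P _); apply: funext => i.
  by rewrite /shift inE; case: (i \in T) => /=; rewrite ?subr0 ?addr0 ?subrK.
by rewrite /shift inE; case: (i \in T) => /=; rewrite ?subr0 ?addr0 ?subrK.
Qed.

(** A unit step from a negative coordinate reaches at most 0 and adds no condition. *)
Lemma mixdiff_neg P u i : u i < 0 -> mixdiff setT (hint P) u = 0.
Proof.
move=> ui; apply: (@mixdiff_eq _ _ _ _ i); first by rewrite inE.
move=> T /subsetP TS; have iT : i \notin T by apply/negP => /TS; rewrite !inE eqxx.
congr Posz; apply: hcod_ext => k; rewrite /shift inE; case: eqP => [->|_] /=.
  by rewrite (negPf iT) !addr0; case: (u i) ui => //= -[|n].
by rewrite addr0.
Qed.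

(** Division by [t_1 ... t_r - 1] sums [Pprime] along the diagonal, where it telescopes. The sum
    stops at the least [w i]; one step further a coordinate is negative and the mixed difference is
    0. *)
Lemma Poincare_mixdiff P (w : 'I_r -> nat) : (0 < r)%N ->
  Poincare P w = - mixdiff setT (hint P) (fun i => (w i)%:Z).
Proof.
move=> r0; pose q (k : nat) := mixdiff setT (hint P) (fun i => (w i)%:Z - k%:Z).
have [i0 min0] : exists i0, forall i, (w i0 <= w i)%N.
  by case: (arg_minnP w (isT : xpredT (Ordinal r0))) => i _ H; exists i => j; exact: H.
have ws : (w i0 <= \sum_i w i)%N by rewrite (bigD1 i0) //= leq_addr.
rewrite /Poincare; congr (- _).
transitivity (\sum_(k < (w i0).+1) (q k - q k.+1)).
  rewrite (big_ord_widen (\sum_i w i).+1 (fun k => q k - q k.+1)) //.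
  apply: eq_big => [k|k /forallP kw].
    rewrite ltnS; apply/forallP/idP => [/(_ i0) //|kw i]; exact: leq_trans kw (min0 i).
  rewrite Pprime_mixdiff; congr (_ - _); rewrite /q; congr mixdiff; apply: funext => i.
    by rewrite subzn.
  by rewrite -subzn // -addrA -opprD -PoszD addn1.
have -> : \sum_(k < (w i0).+1) (q k - q k.+1) = q 0%N - q (w i0).+1.
  rewrite -[RHS]opprB -(telescope_sumr q (leq0n _)) big_mkord -sumrN.
  by apply: eq_bigr => k _; rewrite opprB.
rewrite [q (w i0).+1](@mixdiff_neg _ _ i0) ?subr0; last by lia.
by rewrite /q; congr mixdiff; apply: funext => i; rewrite subr0.
Qed.

(** By Izumi's inequality a large value at [P j] forces order at least [K] at the origin, hence
    value at least [K] at [P i], so raising the bound there to at most [K] is no further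
    condition. *)
Lemma hcod_far P i j (K : nat) : exists W : nat, forall u,
  W%:Z <= u j -> u i < K%:Z -> hcod P (shift u [set i]) = hcod P u.
Proof.
exists (2 ^ size (P j) * K)%N => u uj ui.
apply: cod_uniq (hcodP P _) (hcodP P _) _ => f; split=> /famofP H; apply/famofP => k.
  have := H k; rewrite /shift inE; case: eqP => [-> _|_]; last by rewrite addr0.
  have /(@pull_ordge_inv R) : ordge (2 ^ size (P j) * K) (pull (P j) f).
    by apply: ordgeW (H j); case: (u j) uj => //= n; lia.
  move=> /(pull_ordge (P i)); apply: ordgeW.
  by case: (u i) ui => [n|[|n]] /=; lia.
apply: ordgeW (H k); rewrite /shift inE; case: eqP => _; rewrite /= ?addr0 //.
by case: (u k) => [n|[|n]] /=; lia.
Qed.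

Lemma hcod_zero P : hcod P (fun=> 0) = 0%N.
Proof. by apply: (cod_full (hcodP P _)) => f; apply/famofP => i; exact: ordge0. Qed.

Lemma Poincare_determines_hcod P P' : (0 < r)%N ->
  (forall w, Poincare P w = Poincare P' w) ->
  forall w : 'I_r -> nat, hcod P (fun i => (w i)%:Z) = hcod P' (fun i => (w i)%:Z).
Proof.
move=> r0 H; pose D u := hint P u - hint P' u.
have DE S u : mixdiff S D u = mixdiff S (hint P) u - mixdiff S (hint P') u.
  by rewrite /mixdiff -sumrB; apply: eq_bigr => T _; rewrite mulrBr.
have D0 : forall w : 'I_r -> nat, D (fun i => (w i)%:Z) = 0.
  apply: mixdiff_inj => //.
  - move=> u; rewrite DE; case: (pselect (exists i, u i < 0)) => [[i ui]|pos].
      by rewrite !(mixdiff_neg _ ui) subrr.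
    have -> : u = (fun i => (natpart (u i))%:Z).
      apply: funext => i; case E : (u i) => [n|n] //.
      by case: pos; exists i; rewrite E.
    have := H (fun i => natpart (u i)); rewrite !Poincare_mixdiff // => /oppr_inj ->.
    exact: subrr.
  - move=> i j ij K; have [W HW] := hcod_far P i j K; have [W' HW'] := hcod_far P' i j K.
    exists (W + W')%N => u uj ui; rewrite /D /hint HW ?HW' //; lia.
  - by rewrite /D /hint !hcod_zero.
by move=> w; have /eqP := D0 w; rewrite subr_eq0 => /eqP [].
Qed.

End PoincareDetermines.

(** * Recovering the multiplicities and the common points *)

Lemma hcod_determines_cod (R : realType) r (P P' : 'I_r -> ipt R)
  (w : 'I_r -> nat) F F' m :
  hcod P (fun i => (w i)%:Z) = hcod P' (fun i => (w i)%:Z) ->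
  (forall f, Jfam F f <-> forall i, ordge (w i) (pull (P i) f)) ->
  (forall f, Jfam F' f <-> forall i, ordge (w i) (pull (P' i) f)) ->
  cod (Jfam F) m -> cod (Jfam F') m.
Proof.
move=> h HF HF' cm.
have -> : m = hcod P (fun i => (w i)%:Z).
  by apply: (cod_uniq cm (hcodP P _)) => f; rewrite famofP HF.
rewrite h; have [m' cm'] := cod_Jfam F'.
suff <- : m' = hcod P' (fun i => (w i)%:Z) by [].
by apply: (cod_uniq cm' (hcodP P' _)) => f; rewrite famofP HF'.
Qed.

(** The bound 0 imposes nothing, so a weight supported at [i] isolates one valuation. *)
Lemma single_famP (R : realType) r (P : 'I_r -> ipt R) i k f :
  Jfam [:: (P i, k)] f <->
  forall j, ordge (if j == i then k else 0) (pull (P j) f).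
Proof.
split=> [H j|H pw]; last by rewrite inE => /eqP ->; have := H i; rewrite eqxx.
by case: eqP => [->|_] //; apply: (H (P i, k)); rewrite inE.
Qed.

Lemma pair_famP (R : realType) r (P : 'I_r -> ipt R) i j k l f : i != j ->
  Jfam [:: (P i, k); (P j, l)] f <->
  forall t, ordge (if t == i then k else if t == j then l else 0) (pull (P t) f).
Proof.
move=> ij; split=> [H t|H pw].
  case: eqP => [->|_]; first by apply: (H (P i, k)); rewrite !inE eqxx.
  by case: eqP => [->|_] //; apply: (H (P j, l)); rewrite !inE eqxx orbT.
rewrite !inE => /orP [] /eqP ->; first by have := H i; rewrite eqxx.
by have := H j; rewrite eqxx eq_sym (negPf ij).
Qed.

(** Weights extremal for [p] are tested in [single_lower] for [p'], and conversely, so the Legendre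
    transforms agree; the slope 2 is the one [legS_inj] asks for. *)
Lemma emults_determined (R : realType) (p p' : ipt R) :
  (forall w m, cod (Jfam [:: (p, w)]) m <-> cod (Jfam [:: (p', w)]) m) ->
  emults p = emults p'.
Proof.
move=> H; apply: legS_inj; rewrite ?emults_sorted ?emults_gt0 // => b b0.
apply/eqP; rewrite eqn_leq; apply/andP; split.
  have [w [m [/H cm le]]] := single_upper 2 p b0.
  by have := leq_trans le (single_lower 2 b0 cm); rewrite leq_add2l.
have [w [m [/H cm le]]] := single_upper 2 p' b0.
by have := leq_trans le (single_lower 2 b0 cm); rewrite leq_add2l.
Qed.

(** The same comparison with slopes 1 gives equal transforms for the pairs; removing the equal
    single transforms leaves equal intersection numbers. *)
Lemma lcp_determined (R : realType) (p q p' q' : ipt R) :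
  emults p = emults p' -> emults q = emults q' ->
  (forall k l m, cod (Jfam [:: (p, k); (q, l)]) m <->
                 cod (Jfam [:: (p', k); (q', l)]) m) ->
  lcp p q = lcp p' q'.
Proof.
move=> ep eq H; apply: cross_lcp => //; have b1 : (0 < 1)%N by [].
have : legS 1 1 (emults2 p q) = legS 1 1 (emults2 p' q').
  apply/eqP; rewrite eqn_leq; apply/andP; split.
    have [k [l [m [/H cm le]]]] := pair_upper 1 p q b1.
    by have := leq_trans le (pair_lower 1 b1 cm); rewrite leq_add2l.
  have [k [l [m [/H cm le]]]] := pair_upper 1 p' q' b1.
  by have := leq_trans le (pair_lower 1 b1 cm); rewrite leq_add2l.
by rewrite !legS_emults2 ep eq => /addnI.
Qed.

Lemma lcp_refl (R : realType) (p : ipt R) : lcp p p = size p.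
Proof. by elim: p => [|d p IH] //=; rewrite eqxx IH. Qed.

Theorem theorem1 (R : realType) (r : nat) (hr : (0 < r)%N)
  (M M' : seq (ipt R)) (P P' : 'I_r -> ipt R) :
  is_modif M -> is_modif M' ->
  injective P -> injective P' ->
  (forall i, P i \in M) -> (forall i, P' i \in M') ->
  (forall w : 'I_r -> nat, Poincare P w = Poincare P' w) ->
  comb_equiv P P'.
Proof.
move=> _ _ _ _ _ _ HP.
have h := Poincare_determines_hcod hr HP.
have ee i : emults (P i) = emults (P' i).
  apply: emults_determined => k m; pose w t := if t == i then k else 0%N.
  split.
    by apply: (hcod_determines_cod (h w)) => f; exact: single_famP.
  by apply: (hcod_determines_cod (esym (h w))) => f; exact: single_famP.
apply: comb_equiv_of_emults => // i j.
(* Pairs need distinct indices; for [i = j] the value of [lcp] is the length of the chain, known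
   from its multiplicities. *)
case: (eqVneq i j) => [<-|ij].
  by rewrite !lcp_refl; have := congr1 size (ee i); rewrite !size_emults => -[].
apply: lcp_determined => // k l m.
pose w t := if t == i then k else if t == j then l else 0%N.
split.
  by apply: (hcod_determines_cod (h w)) => f; exact: pair_famP.
by apply: (hcod_determines_cod (esym (h w))) => f; exact: pair_famP.
Qed.
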